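(* Let $\{\underline{X}_t\}_{t\in\mathbb{Z}}$ be a centred real $p$-dimensional time series whose covariance operator satisfies $0<\lambda_{\inf}\le\lambda_{\sup}<\infty$, let $D=(D_{a,b})_{1\le a,b\le p}$ be the associated operator built from the projection coefficients, and let $\rho^{(a,b)}=(\rho^{(a,b)}_{t,\tau})_{t,\tau\in\mathbb{Z}}$ be the partial covariances. Then: (i) (Conditional noncorrelation) for $a\neq b$: $\rho^{(a,b)}_{t,\tau}=0$ for all $t,\tau\in\mathbb{Z}$ if and only if $D_{a,b}=0$. (ii) (Conditionally stationary node) for every $a$: $D_{a,a}$ is Toeplitz if and only if $\rho^{(a,a)}_{t,\tau}=\rho^{(a,a)}_{0,t-\tau}$ for all $t,\tau\in\mathbb{Z}$, i.e. $\rho^{(a,a)}$ is Toeplitz. (iii) (Conditionally stationary pair) for $a\neq b$: $D_{a,a}$, $D_{b,b}$ and $D_{a,b}$ are all Toeplitz if and only if $\rho^{(a,a)}$, $\rho^{(b,b)}$ and $\rho^{(a,b)}$ are all Toeplitz.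
   Context: Fix $p\ge1$. $\{\underline{X}_t\}_{t\in\mathbb{Z}}$, $\underline{X}_t=(X_t^{(1)},\dots,X_t^{(p)})'$, is a real-valued time series with mean zero and finite variances on a probability space; ${\bf C}_{t,\tau}=\mathrm{Cov}(\underline{X}_t,\underline{X}_\tau)$ is $p\times p$, with $\sup_t\|{\bf C}_{t,t}\|_\infty<\infty$ ($\|\cdot\|_\infty$ = largest absolute entry). $\ell_2$ is the Hilbert space of square-summable complex sequences indexed by $\mathbb{Z}$, and $\ell_{2,p}$ the Hilbert space of $v=\mathrm{vec}[u^{(1)},\dots,u^{(p)}]$ with $u^{(s)}\in\ell_2$, with inner product the sum of the $\ell_2$ inner products. $C=(C_{a,b})_{1\le a,b\le p}$ is the infinite block matrix with $[C_{a,b}]_{t,\tau}=[{\bf C}_{t,\tau}]_{a,b}$, acting on $\ell_{2,p}$ by matrix multiplication; $\lambda_{\sup}=\sup_{\|v\|_2=1}\langle v,Cv\rangle$ and $\lambda_{\inf}=\inf_{\|v\|_2=1}\langle v,Cv\rangle$ over $v\in\ell_{2,p}$. $\mathcal{H}$ is the closed linear span (in the $L^2$ space with inner product $\mathrm{Cov}$) of all $X_t^{(c)}$, $t\in\mathbb{Z}$, $1\le c\le p$; $P_{\mathcal{M}}$ is the orthogonal projection onto a closed subspace $\mathcal{M}$. $\mathcal{H}-X_t^{(a)}$ is the closed span of all $X_s^{(c)}$ with $(s,c)\ne(t,a)$; $\mathcal{H}-(X_t^{(a)},X_\tau^{(b)})$ is the closed span of all $X_s^{(c)}$ with $(s,c)\notin\{(t,a),(\tau,b)\}$.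 When $0<\lambda_{\inf}\le\lambda_{\sup}<\infty$ there are unique coefficients with $P_{\mathcal{H}-X_t^{(a)}}(X_t^{(a)})=\sum_{\tau\in\mathbb{Z}}\sum_{b=1}^p\beta_{(\tau,b)\to(t,a)}X_\tau^{(b)}$, $\beta_{(t,a)\to(t,a)}=0$; put $\sigma_{a,t}^2=\mathrm{E}[X_t^{(a)}-P_{\mathcal{H}-X_t^{(a)}}(X_t^{(a)})]^2$. Define $[D_{a,b}]_{t,\tau}=1/\sigma_{a,t}^2$ if $(a,t)=(b,\tau)$, and $[D_{a,b}]_{t,\tau}=-\beta_{(\tau,b)\to(t,a)}/\sigma^2_{a,t}$ otherwise; $D=(D_{a,b})$. The partial covariance is $\rho^{(a,b)}_{t,\tau}=\mathrm{Cov}\big[X_t^{(a)}-P_{\mathcal{H}-(X_t^{(a)},X_\tau^{(b)})}(X_t^{(a)}),\,X_\tau^{(b)}-P_{\mathcal{H}-(X_t^{(a)},X_\tau^{(b)})}(X_\tau^{(b)})\big]$, so that $\rho^{(a,a)}_{t,t}=\sigma_{a,t}^2$. An infinite matrix $A=(A_{t,\tau})_{t,\tau\in\mathbb{Z}}$ is Toeplitz if $A_{t,\tau}=a_{t-\tau}$ for some sequence $(a_r)_{r\in\mathbb{Z}}$; it is zero if all entries are zero. *)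

(* Defs.v *)
From HB Require Import structures.
From mathcomp Require Import all_boot all_order all_algebra.
From mathcomp Require Import complex.
From mathcomp Require Import all_classical all_reals all_analysis.

Set Implicit Arguments.
Unset Strict Implicit.
Unset Printing Implicit Defensive.

Import Order.TTheory GRing.Theory Num.Theory.
Import numFieldNormedType.Exports.

Local Open Scope classical_set_scope.
Local Open Scope ring_scope.

(* Sums over int are limits of the symmetric partial sums over -n, ..., n. *)
Definition psumZ (V : nmodType) (f : int -> V) (n : nat) : V :=
  \sum_(k < n.*2.+1) f (k%:Z - n%:Z).

Definition toeplitz (R : Type) (A : int -> int -> R) : Prop :=
  exists a : int -> R, forall t tau, A t tau = a (t - tau).

Definition sumZ (R : realType) (f : int -> R[i]) : R[i] :=
  limn (psumZ f : nat -> (R[i] : numFieldType)).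

Definition l2 (R : realType) (u : int -> R[i]) : Prop :=
  (\esum_(t in [set: int]) ((Normc.normc (u t)) ^+ 2)%:E < +oo)%E.

Definition l2p (R : realType) (p : nat) (v : 'I_p -> int -> R[i]) : Prop :=
  forall s, l2 (v s).

Definition l2p_inner (R : realType) (p : nat) (u v : 'I_p -> int -> R[i])
    : R[i] :=
  \sum_(s < p) sumZ (fun t => (u s t)^* * v s t).

Definition l2p_norm (R : realType) (p : nat) (v : 'I_p -> int -> R[i]) : R :=
  Num.sqrt (complex.Re (l2p_inner v v)).

Definition l2p_sphere (R : realType) (p : nat) : set ('I_p -> int -> R[i]) :=
  [set v | l2p v /\ l2p_norm v = 1].

(* Block matrices are written A a b t tau, for the entry (t, tau) of the
   block (a, b). *)
Definition block_act (R : realType) (p : nat)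
    (A : 'I_p -> 'I_p -> int -> int -> R) (v : 'I_p -> int -> R[i])
    : 'I_p -> int -> R[i] :=
  fun a t => \sum_(b < p) sumZ (fun tau => (A a b t tau)%:C%C * v b tau).

(* The series in [l2p_inner v (block_act A v)] are finite sums when v is
   finitely supported.  For a symmetric A, finiteness of [lambda_inf A] and
   [lambda_sup A] therefore already forces A to be a bounded operator, and then
   all these series converge absolutely, for every v in l_{2,p}.  The value is
   real for symmetric A, hence [complex.Re]. *)
Definition lambda_sup (R : realType) (p : nat)
    (A : 'I_p -> 'I_p -> int -> int -> R) : \bar R :=
  ereal_sup [set (complex.Re (l2p_inner v (block_act A v)))%:E |
             v in @l2p_sphere R p].

Definition lambda_inf (R : realType) (p : nat)
    (A : 'I_p -> 'I_p -> int -> int -> R) : \bar R :=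
  ereal_inf [set (complex.Re (l2p_inner v (block_act A v)))%:E |
             v in @l2p_sphere R p].

Definition cov d (T : measurableType d) (R : realType) (P : probability T R)
    (Y Z : T -> R) : R := fine (covariance P Y Z).

(* On mean-zero variables cov is an inner product, modulo a.s. equality; the
   elements below are functions, not classes for a.s. equality. *)
Definition L2c d (T : measurableType d) (R : realType) (P : probability T R)
    : set (T -> R) :=
  [set Y | Y \in Lfun P 2%:E /\ 'E_P[Y]%E = 0%E].

Definition L2c_norm d (T : measurableType d) (R : realType)
    (P : probability T R) (Y : T -> R) : R := Num.sqrt (cov P Y Y).

Definition lin_span (T : Type) (R : realType) (G : set (T -> R))
    : set (T -> R) :=
  [set Y | exists (n : nat) (c : 'I_n -> R) (g : 'I_n -> T -> R),
     (forall i, G (g i)) /\ Y = (fun w => \sum_(i < n) c i * g i w)].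

Definition closed_span d (T : measurableType d) (R : realType)
    (P : probability T R) (G : set (T -> R)) : set (T -> R) :=
  [set Y | L2c P Y /\ forall eps : R, 0 < eps ->
     exists Z, lin_span G Z /\ L2c_norm P (Y \- Z) < eps].

Definition is_orth_proj d (T : measurableType d) (R : realType)
    (P : probability T R) (M : set (T -> R)) (Y Z : T -> R) : Prop :=
  M Z /\ forall W, M W -> cov P (Y \- Z) W = 0.

(* A version of the projection, which is unique up to a.s. equality. *)
Definition orth_proj d (T : measurableType d) (R : realType)
    (P : probability T R)
    (M : set (T -> R)) (Y : T -> R) : T -> R :=
  xget (fun=> 0) [set Z | is_orth_proj P M Y Z].

Definition acov d (T : measurableType d) (R : realType) (P : probability T R)
    (p : nat) (X : int -> 'I_p -> {RV P >-> R}) (t tau : int) : 'M[R]_p :=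
  \matrix_(a, b) cov P (X t a) (X tau b).

Definition Cop d (T : measurableType d) (R : realType) (P : probability T R)
    (p : nat) (X : int -> 'I_p -> {RV P >-> R})
    (a b : 'I_p) (t tau : int) : R := acov X t tau a b.

(* The closed span of the X_s^(c) whose index (s, c) lies outside A. *)
Definition Hminus d (T : measurableType d) (R : realType)
    (P : probability T R) (p : nat) (X : int -> 'I_p -> {RV P >-> R})
    (A : set (int * 'I_p)) : set (T -> R) :=
  closed_span P [set (X i.1 i.2 : T -> R) | i in ~` A].

Definition resid d (T : measurableType d) (R : realType)
    (P : probability T R) (p : nat) (X : int -> 'I_p -> {RV P >-> R})
    (A : set (int * 'I_p)) (t : int) (a : 'I_p) : T -> R :=
  (X t a : T -> R) \- orth_proj P (Hminus X A) (X t a).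

(* The series of the w_tau^(b) X_tau^(b) converges in L^2 to the projection of
   X_t^(a) on the closed span of the other variables. *)
Definition is_beta d (T : measurableType d) (R : realType)
    (P : probability T R) (p : nat) (X : int -> 'I_p -> {RV P >-> R})
    (t : int) (a : 'I_p) (w : int -> 'I_p -> R) : Prop :=
  w t a = 0 /\
  (fun n => L2c_norm P (orth_proj P (Hminus X [set (t, a)]) (X t a) \-
      (fun x => psumZ (fun tau => \sum_(b < p) w tau b * X tau b x) n)))
    @ \oo --> (0 : R).

(* [beta X t a tau b] is the coefficient beta_{(tau,b) -> (t,a)}. *)
Definition beta d (T : measurableType d) (R : realType) (P : probability T R)
    (p : nat) (X : int -> 'I_p -> {RV P >-> R}) (t : int) (a : 'I_p)
    : int -> 'I_p -> R :=
  xget (fun _ _ => 0) [set w | is_beta X t a w].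

Definition sigma2 d (T : measurableType d) (R : realType)
    (P : probability T R) (p : nat) (X : int -> 'I_p -> {RV P >-> R})
    (a : 'I_p) (t : int) : R :=
  fine 'E_P[(fun x => resid X [set (t, a)] t a x ^+ 2)%R]%E.

Definition Dop d (T : measurableType d) (R : realType) (P : probability T R)
    (p : nat) (X : int -> 'I_p -> {RV P >-> R})
    (a b : 'I_p) (t tau : int) : R :=
  if (a, t) == (b, tau) then (sigma2 X a t)^-1
  else - beta X t a tau b / sigma2 X a t.

Definition pcov d (T : measurableType d) (R : realType) (P : probability T R)
    (p : nat) (X : int -> 'I_p -> {RV P >-> R})
    (a b : 'I_p) (t tau : int) : R :=
  cov P (resid X [set (t, a); (tau, b)] t a)
        (resid X [set (t, a); (tau, b)] tau b).

(* Main.v *)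
Require Import Defs.
From HB Require Import structures.
From mathcomp Require Import all_boot all_order all_algebra.
From mathcomp Require Import complex.
From mathcomp Require Import all_classical all_reals all_analysis.
From mathcomp Require Import measurable_realfun zify ring lra.

(** On centred square-integrable variables [cov P] is an inner product, and
    the space they form is complete, so every variable has an orthogonal
    projection on a closed span ([orth_projection_exists]).  Evaluating the
    quadratic form of the covariance operator on finitely supported vectors
    turns [0 < lambda_inf] and [lambda_sup < +oo] into frame bounds
    ([frame_bounds]): the squared norm of a finite combination of the X_i,
    where i = (t, a), lies between m and M times the sum of its squared
    coefficients, with m > 0.

    Let e_i be the residual of X_i after projection on all the other
    variables.  The lower bound gives sigma_i^2 = cov (e_i, e_i) > 0, and
    Z_i = e_i / sigma_i^2 is then the family dual to X: cov (X_j, Z_i) is 1 if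
    i = j and 0 otherwise.  The frame bounds make the expansion
    Y = sum_i cov (Y, Z_i) X_i converge in norm on the whole closed span
    ([dual_expansion]).  Applied to the projection of X_i, it shows that the
    coefficients beta exist and equal cov (projection of X_i, Z_j), whence
    D_ij = cov (Z_i, Z_j) ([DopE]): D is the Gram matrix of the dual family,
    the inverse of the covariance operator.

    For a pair i <> j, the residuals of X_i and X_j after projection on the
    variables other than these two lie in the plane spanned by Z_i and Z_j, and
    their covariance matrix is the inverse of the 2 x 2 block of D at i, j
    ([partial_cov_gram]).  Hence rho_ii = 1 / D_ii and
    rho_ij = - D_ij / (D_ii D_jj - D_ij^2), where the denominator is positive.
    The first claim is read off from this formula.  Once the diagonal entries
    are known, rho_ij determines D_ij, because x / (K - x^2) is injective where
    x^2 < K ([ratio_inj]); so D and rho have the same translation invariances,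
    which gives the claims on Toeplitz blocks.  For a
    Toeplitz rho^(a,a) the sign of the lag is immaterial, because rho^(a,a) is
    symmetric. *)

Set Implicit Arguments.
Unset Strict Implicit.
Unset Printing Implicit Defensive.

Import Order.TTheory GRing.Theory Num.Theory.
Import numFieldNormedType.Exports.

Local Open Scope classical_set_scope.
Local Open Scope ring_scope.

(** * Covariance as an inner product on the centred square-integrable variables *)

(** For [c = 0] the nonnegative polynomial is affine in [t], so [b] vanishes;
    otherwise it is evaluated at its minimum [t = - b / c]. *)
Lemma quad_ge0_discr (R : realFieldType) (a b c : R) : 0 <= c ->
  (forall t, 0 <= a + 2 * t * b + t ^+ 2 * c) -> b ^+ 2 <= a * c.
Proof.
rewrite le_eqVlt => /orP[/eqP<-|c0] quad.
  rewrite mulr0; have [->|b0] := eqVneq b 0; first by rewrite expr0n.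
  have := quad (- (a + 1) / (2 * b)).
  have -> : a + 2 * (- (a + 1) / (2 * b)) * b + (- (a + 1) / (2 * b)) ^+ 2 * 0 = -1.
    by field.
  by rewrite oppr_ge0 ler10.
have := quad (- b / c).
have -> : a + 2 * (- b / c) * b + (- b / c) ^+ 2 * c = (a * c - b ^+ 2) / c.
  by field; rewrite gt_eqF.
by rewrite pmulr_lge0 ?invr_gt0// subr_ge0.
Qed.

Lemma le0_of_geometric (R : realType) (x K : R) :
  (forall n, x <= geometric K 2^-1 n) -> x <= 0.
Proof.
move=> xK; have g0 : geometric K 2^-1 @ \oo --> (0 : R).
  by apply: cvg_geometric; rewrite ger0_norm// invf_lt1// ltr1n.
by apply: (cvgr_to_ge g0); exact: nearW.
Qed.

Section L2c_theory.
Context d (T : measurableType d) (R : realType) (P : probability T R).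
Implicit Types (Y Z W : T -> R) (G : set (T -> R)).

Let Pfin : P setT \is a fin_num := fin_num_measure P _ measurableT.

Lemma Lfun2_Lfun1 Y : Y \in Lfun P 2%:E -> Y \in Lfun P 1.
Proof. exact: Lfun_subset12. Qed.

Lemma L2c0 : L2c P (fun=> 0).
Proof.
split; last exact: expectation_cst.
by have := Lfun_cst P 0 2.
Qed.

Lemma L2cZ k Y : L2c P Y -> L2c P (k *: Y).
Proof.
have -> : k *: Y = k \o* Y by apply/funext => w /=; rewrite mulrC.
move=> [Y2 Y0]; split; first by rewrite Lfun_scale// ler1n.
by rewrite expectationZl ?Y0 ?mule0// Lfun2_Lfun1.
Qed.

Lemma L2cD Y Z : L2c P Y -> L2c P Z -> L2c P (Y + Z).
Proof.
move=> [Y2 Y0] [Z2 Z0]; split; first by rewrite rpredD ?lee1n.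
by rewrite expectationD ?Lfun2_Lfun1// Y0 Z0 adde0.
Qed.

Lemma L2cN Y : L2c P Y -> L2c P (- Y).
Proof. by rewrite -scaleN1r; apply: L2cZ. Qed.

Lemma L2cB Y Z : L2c P Y -> L2c P Z -> L2c P (Y - Z).
Proof. by move=> hY hZ; apply/L2cD/L2cN. Qed.

Lemma L2c_sum (I : Type) (r : seq I) (Q : pred I) (F : I -> T -> R) :
  (forall i, Q i -> L2c P (F i)) -> L2c P (\sum_(i <- r | Q i) F i).
Proof.
by move=> F2; apply: (big_ind (L2c P)); [exact: L2c0|exact: L2cD|].
Qed.

Lemma covC Y Z : cov P Y Z = cov P Z Y.
Proof. by rewrite /cov covarianceC. Qed.

Lemma covE Y Z : L2c P Y -> L2c P Z -> ((cov P Y Z)%:E = 'E_P[Y \* Z])%E.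
Proof.
move=> [Y2 Y0] [Z2 Z0].
have YZ := Lfun2_mul_Lfun1 Y2 Z2.
rewrite /cov; have -> : covariance P Y Z = ('E_P[(Y * Z)%R] - 'E_P[Y] * 'E_P[Z])%E.
  by apply: covarianceE => //; exact: Lfun2_Lfun1.
by rewrite Y0 mul0e sube0 fineK//; exact: expectation_fin_num.
Qed.

Lemma Lfun2_covariance_fin_num Y Z : Y \in Lfun P 2%:E -> Z \in Lfun P 2%:E ->
  covariance P Y Z \is a fin_num.
Proof.
move=> Y2 Z2; apply: covariance_fin_num; [exact: Lfun2_Lfun1..|].
exact: Lfun2_mul_Lfun1.
Qed.

Lemma covDl Y Z W : L2c P Y -> L2c P Z -> L2c P W ->
  cov P (Y + Z) W = cov P Y W + cov P Z W.
Proof.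
move=> [Y2 Y0] [Z2 Z0] [W2 W0].
by rewrite /cov covarianceDl// fineD// Lfun2_covariance_fin_num.
Qed.

Lemma covZl k Y W : L2c P Y -> L2c P W -> cov P (k *: Y) W = k * cov P Y W.
Proof.
have -> : k *: Y = k \o* Y by apply/funext => w /=; rewrite mulrC.
move=> [Y2 Y0] [W2 W0].
rewrite /cov; have -> : covariance P (k \o* Y) W = (k%:E * covariance P Y W)%E.
  by apply: covarianceZl; [exact: Lfun2_Lfun1.. | exact: Lfun2_mul_Lfun1].
by rewrite fineM// Lfun2_covariance_fin_num.
Qed.

Lemma covNl Y W : L2c P Y -> L2c P W -> cov P (- Y) W = - cov P Y W.
Proof. by move=> *; rewrite -scaleN1r covZl// mulN1r. Qed.

Lemma covBl Y Z W : L2c P Y -> L2c P Z -> L2c P W ->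
  cov P (Y - Z) W = cov P Y W - cov P Z W.
Proof. by move=> *; rewrite covDl ?covNl//; exact: L2cN. Qed.

Lemma covDr Y Z W : L2c P Y -> L2c P Z -> L2c P W ->
  cov P W (Y + Z) = cov P W Y + cov P W Z.
Proof. by move=> *; rewrite !(covC W) covDl. Qed.

Lemma covZr k Y W : L2c P Y -> L2c P W -> cov P W (k *: Y) = k * cov P W Y.
Proof. by move=> *; rewrite !(covC W) covZl. Qed.

Lemma covBr Y Z W : L2c P Y -> L2c P Z -> L2c P W ->
  cov P W (Y - Z) = cov P W Y - cov P W Z.
Proof. by move=> *; rewrite !(covC W) covBl. Qed.

Lemma cov0l W : cov P (fun=> 0) W = 0.
Proof. by have := @covariance_cst_l _ _ _ P 0 W; rewrite /cov => ->. Qed.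

Lemma cov_suml (I : Type) (r : seq I) (F : I -> T -> R) W :
  (forall i, L2c P (F i)) -> L2c P W ->
  cov P (\sum_(i <- r) F i) W = \sum_(i <- r) cov P (F i) W.
Proof.
move=> F2 W2; elim: r => [|i r IH]; first by rewrite !big_nil cov0l.
by rewrite !big_cons covDl// ?IH//; exact: L2c_sum.
Qed.

Lemma cov_ge0 Y : 0 <= cov P Y Y.
Proof. by rewrite /cov fine_ge0// variance_ge0. Qed.

Lemma CauchySchwarz_cov Y Z : L2c P Y -> L2c P Z ->
  cov P Y Z ^+ 2 <= cov P Y Y * cov P Z Z.
Proof.
move=> hY hZ; set a := cov P Y Y; set b := cov P Y Z; set c := cov P Z Z.
apply: quad_ge0_discr (cov_ge0 _) _ => t; rewrite -/a -/b -/c.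
have := cov_ge0 (Y + t *: Z); have tZ := L2cZ t hZ; have YtZ := L2cD hY tZ.
rewrite covDl// !covDr// !covZl// !covZr// (covC Z Y) -/a -/b -/c.
by congr (0 <= _); ring.
Qed.

Lemma L2c_norm_ge0 Y : 0 <= L2c_norm P Y.
Proof. exact: sqrtr_ge0. Qed.

Lemma sqr_L2c_norm Y : L2c_norm P Y ^+ 2 = cov P Y Y.
Proof. by rewrite sqr_sqrtr ?cov_ge0. Qed.

Lemma ler_cov_norm Y Z : L2c P Y -> L2c P Z ->
  `|cov P Y Z| <= L2c_norm P Y * L2c_norm P Z.
Proof.
move=> hY hZ; rewrite -sqrtr_sqr -sqrtrM ?cov_ge0// ler_wsqrtr//.
exact: CauchySchwarz_cov.
Qed.

Lemma cov_null Y Z : L2c P Y -> L2c P Z -> cov P Y Y = 0 -> cov P Y Z = 0.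
Proof.
move=> hY hZ Y0; have := CauchySchwarz_cov hY hZ; rewrite Y0 mul0r.
by rewrite real_exprn_even_le0 ?num_real// => /eqP.
Qed.

Lemma ler_L2c_normD Y Z : L2c P Y -> L2c P Z ->
  L2c_norm P (Y + Z) <= L2c_norm P Y + L2c_norm P Z.
Proof.
move=> hY hZ; rewrite -(@ler_pXn2r _ 2) ?nnegrE ?addr_ge0 ?L2c_norm_ge0//.
rewrite sqrrD !sqr_L2c_norm covDl ?covDr//; last exact: L2cD.
rewrite (covC Z Y); have := ler_cov_norm hY hZ; have := ler_norm (cov P Y Z).
lra.
Qed.

Lemma L2c_normN Y : L2c P Y -> L2c_norm P (- Y) = L2c_norm P Y.
Proof.
move=> hY; rewrite /L2c_norm covNl//; last exact: L2cN.
by rewrite covC covNl// opprK.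
Qed.

Lemma L2c_normBC Y Z : L2c P Y -> L2c P Z ->
  L2c_norm P (Y - Z) = L2c_norm P (Z - Y).
Proof. by move=> hY hZ; rewrite -L2c_normN ?opprB//; exact: L2cB. Qed.

Lemma ler_L2c_normB Y Z W : L2c P Y -> L2c P Z -> L2c P W ->
  L2c_norm P (Y - Z) <= L2c_norm P (Y - W) + L2c_norm P (W - Z).
Proof.
move=> hY hZ hW; have -> : Y - Z = (Y - W) + (W - Z) by rewrite addrA subrK.
by apply: ler_L2c_normD; exact: L2cB.
Qed.

End L2c_theory.

(** * Completeness of the space of centred square-integrable variables *)

Section completeness.
Context d (T : measurableType d) (R : realType) (P : probability T R).
Implicit Types (Y Z W : T -> R).

Lemma Lfun2_measurable Y : Y \in Lfun P 2%:E -> measurable_fun setT Y.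
Proof. by rewrite inE => /andP[/[!inE]]. Qed.

Lemma Lfun2_of_sqr Y : measurable_fun setT Y ->
  (\int[P]_x ((Y x) ^+ 2)%:E < +oo)%E -> Y \in Lfun P 2%:E.
Proof.
move=> mY Yoo; rewrite inE; apply/andP; split; rewrite inE//=.
rewrite /finite_norm unlock /=.
rewrite poweR_lty//.
rewrite (eq_integral (fun x => ((Y x) ^+ 2)%:E))// => x _.
by rewrite powR_mulrn// real_normK ?num_real.
Qed.

(** The variance of the absolute value of [Y] is nonnegative, which bounds the
    L^1 norm by the L^2 norm on a probability space. *)
Lemma expectation_norm_le Y (c : R) : 0 <= c -> Y \in Lfun P 2%:E ->
  (\int[P]_x ((Y x) ^+ 2)%:E <= (c ^+ 2)%:E)%E -> ('E_P[Num.norm \o Y] <= c%:E)%E.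
Proof.
move=> c0 Y2 Yc.
have nY : Num.norm \o Y \in Lfun P 2%:E.
  apply: Lfun2_of_sqr; first exact/measurableT_comp/Lfun2_measurable.
  under eq_integral do rewrite /= real_normK ?num_real//.
  exact: le_lt_trans Yc (ltry _).
have := variance_ge0 P (Num.norm \o Y); rewrite varianceE//.
have fE : 'E_P[Num.norm \o Y]%E \is a fin_num by exact/expectation_fin_num/Lfun2_Lfun1.
have -> : ('E_P[(Num.norm \o Y) ^+ 2] = \int[P]_x ((Y x) ^+ 2)%:E)%E.
  by rewrite unlock; apply: eq_integral => x _ /=; rewrite -[in RHS]real_normK ?num_real.
rewrite -(fineK fE) -EFin_expe sube_ge0// => /le_trans/(_ Yc).
rewrite !lee_fin ler_pXn2r// nnegrE// fine_ge0//.
by apply: expectation_ge0 => x /=.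
Qed.

Lemma L2c_integral_sqr Y : L2c P Y ->
  (\int[P]_x ((Y x) ^+ 2)%:E = (L2c_norm P Y ^+ 2)%:E)%E.
Proof.
by move=> hY; rewrite sqr_L2c_norm covE// unlock; apply: eq_integral.
Qed.

Lemma limn_einf_le (u : (\bar R)^nat) (b : \bar R) :
  (forall n, u n <= b)%E -> (limn_einf u <= b)%E.
Proof.
move=> ub; apply: le_trans (limn_einf_sup u) _.
rewrite limn_esup_lim; apply: lime_le; first exact: is_cvg_esups.
by apply: nearW => n; apply: ge_ereal_sup => _ [m _ <-].
Qed.

(** The L^1 norms of the increments are summable, so by monotone convergence
    the sum of their absolute values is integrable, hence finite almost
    everywhere. *)
Lemma summable_increments_cvg (U : nat -> T -> R) (c : R) :
  (forall n, L2c P (U n)) ->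
  (forall n, L2c_norm P (U n.+1 - U n) <= geometric c 2^-1 n) ->
  {ae P, forall x, cvgn (U ^~ x)}.
Proof.
move=> hU Uc.
pose D n x : R := `|U n.+1 x - U n x|.
have mU n : measurable_fun setT (U n) by exact: Lfun2_measurable (hU n).1.
have mD n : measurable_fun setT (D n).
  by apply: measurableT_comp => //; exact: measurable_funB.
have c0 n : 0 <= geometric c 2^-1 n by exact: le_trans (L2c_norm_ge0 _ _) (Uc n).
have hD n : (\int[P]_x (D n x)%:E <= (geometric c 2^-1 n)%:E)%E.
  have := @expectation_norm_le (U n.+1 - U n) _ (c0 n) (L2cB (hU _) (hU _)).1.
  rewrite expectation.unlock; apply.
  rewrite L2c_integral_sqr; last exact: L2cB.
  by rewrite lee_fin ler_pXn2r// nnegrE ?L2c_norm_ge0.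
pose sD x : \bar R := (\sum_(n <oo) (D n x)%:E)%E.
have sD0 x : (0 <= sD x)%E.
  by apply: nneseries_ge0 => n _ _; rewrite lee_fin normr_ge0.
have mDs : measurable_fun setT sD.
  apply: ge0_emeasurable_sum => [k x _ _|k _]; first by rewrite lee_fin normr_ge0.
  exact/measurable_EFinP.
have iD : P.-integrable setT sD.
  apply/integrableP; split => //.
  under eq_integral do rewrite gee0_abs ?sD0//.
  rewrite integral_nneseries//; [|by move=> n; exact/measurable_EFinP|]; last first.
    by move=> n x _; rewrite lee_fin normr_ge0.
  have gc : cvgn (series (geometric c 2^-1)).
    by apply: is_cvg_geometric_series; rewrite ger0_norm// invf_lt1// ltr1n.
  apply: (@le_lt_trans _ _ (\sum_(n <oo) (geometric c 2^-1 n)%:E)%E).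
    apply: lee_nneseries => // n _ _; apply: integral_ge0 => x _.
    by rewrite lee_fin normr_ge0.
  under eq_fun do rewrite sumEFin.
  by rewrite (EFin_lim gc) ltry.
have := integrable_ae measurableT iD; apply: filterS => x /(_ I) Dx.
have : cvgn (series (fun n => D n x)).
  apply: nnseries_is_cvg => //; first by move=> i; exact: normr_ge0.
  by rewrite ltey_eq Dx.
move=> /(@normed_cvg _ R^o (telescope (U ^~ x))) sx.
have -> : U ^~ x = (cst (U 0%N x)) \+ series (telescope (U ^~ x)).
  by apply/funext => n; exact: (eq_sum_telescope (U ^~ x)).
by apply: is_cvgD => //; exact: is_cvg_cst.
Qed.

(** Riesz-Fischer for a sequence with geometrically decreasing increments: the
    almost everywhere limit is a limit in norm by Fatou's lemma.  A Cauchy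
    sequence has such subsequences, and the minimizing sequence in the
    projection theorem can be chosen of this form. *)
Lemma L2c_complete (U : nat -> T -> R) (c : R) :
  (forall n, L2c P (U n)) ->
  (forall n, L2c_norm P (U n.+1 - U n) <= geometric c 2^-1 n) ->
  exists V, L2c P V /\
    forall n, L2c_norm P (U n - V) <= geometric (c * 2) 2^-1 n.
Proof.
move=> hU Uc.
have mU n : measurable_fun setT (U n) by exact: Lfun2_measurable (hU n).1.
have c0 n : 0 <= geometric c 2^-1 n by exact: le_trans (L2c_norm_ge0 _ _) (Uc n).
have gE n : geometric (c * 2) 2^-1 n.+1 = geometric c 2^-1 n.
  by rewrite /= exprS; field.
have c20 n : 0 <= geometric (c * 2) 2^-1 n.
  by case: n => [|n]; [have := c0 0%N; rewrite /=; lra|rewrite gE].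
have Unm n m : L2c_norm P (U n - U (n + m)%N) <= geometric (c * 2) 2^-1 n.
  suff : L2c_norm P (U n - U (n + m)%N) <=
      geometric (c * 2) 2^-1 n - geometric (c * 2) 2^-1 (n + m)%N.
    by have := c20 (n + m)%N; lra.
  elim: m => [|m IH]; first by rewrite addn0 !subrr /L2c_norm cov0l sqrtr0.
  rewrite addnS; apply: le_trans (ler_L2c_normB (hU _) (hU _) (hU (n + m)%N)) _.
  rewrite [X in _ + X <= _]L2c_normBC//; have := Uc (n + m)%N; move: IH.
  rewrite gE; have -> : geometric (c * 2) 2^-1 (n + m)%N = 2 * geometric c 2^-1 (n + m)%N.
    by rewrite /=; ring.
  lra.
have Ucvg := summable_increments_cvg hU Uc.
pose V x := fine (limn_esup (fun n => (U n x)%:E)).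
have mV : measurable_fun setT V.
  apply: measurableT_comp; first exact: fine_measurable.
  by apply: measurable_fun_limn_esup => n; exact/measurable_EFinP.
have UV : {ae P, forall x, U ^~ x @ \oo --> V x}.
  apply: filterS Ucvg => x /cvg_ex[l Ul].
  have : EFin \o U ^~ x @ \oo --> l%:E by apply: cvg_EFin => //; exact: nearW.
  by move=> /cvg_limn_einf_sup[_]; rewrite /V => ->.
have UnV n : (\int[P]_x ((U n x - V x) ^+ 2)%:E <= (geometric (c * 2) 2^-1 n ^+ 2)%:E)%E.
  pose f m x := ((U n x - U (n + m)%N x) ^+ 2)%:E.
  have mf m : measurable_fun setT (f m).
    by apply/measurable_EFinP; apply: measurable_funX; exact: measurable_funB.
  have f0 m x : setT x -> (0 <= f m x)%E by move=> _; rewrite lee_fin sqr_ge0.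
  apply: (@le_trans _ _ (\int[P]_x limn_einf (f ^~ x))%E); last first.
    apply: le_trans (fatou P measurableT mf f0) _.
    apply: limn_einf_le => m; have := L2c_integral_sqr (L2cB (hU n) (hU (n + m)%N)).
    by rewrite /f => ->; rewrite lee_fin ler_pXn2r// nnegrE ?L2c_norm_ge0.
  rewrite (@ge0_ae_eq_integral _ _ _ P setT _ (fun x => limn_einf (f ^~ x)))//.
  - apply/measurable_EFinP; apply: measurable_funX; exact: measurable_funB.
  - pose g m x := einfs (f ^~ x) m.
    apply: (emeasurable_fun_cvg g) => [m|x _].
      exact: measurable_fun_einfs.
    by rewrite limn_einf_lim; exact: is_cvg_einfs.
  - by move=> x _; rewrite lee_fin sqr_ge0.
  - move=> x _; rewrite limn_einf_lim; apply: lime_ge; first exact: is_cvg_einfs.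
    apply: nearW => m; apply: le_ereal_inf_tmp => _ [k _ <-]; exact: f0.
  - apply: filterS UV => x Ux _.
    have : f ^~ x @ \oo --> ((U n x - V x) ^+ 2)%:E.
      apply: cvg_EFin; first exact: nearW.
      have Unx : (fun m => U n x - U (n + m)%N x) @ \oo --> U n x - V x.
        apply: cvgB; first exact: cvg_cst.
        by move: Ux; rewrite -(cvg_shiftn n); under eq_fun do rewrite addnC.
      exact: (cvgM Unx Unx).
    by move=> /cvg_limn_einf_sup[-> _].
have UV2 n : U n - V \in Lfun P 2%:E.
  apply: Lfun2_of_sqr; first exact: measurable_funB.
  exact: le_lt_trans (UnV n) (ltry _).
have V2 : V \in Lfun P 2%:E.
  rewrite -(subKr (U 0%N) V); by rewrite rpredB ?lee1n//; case: (hU 0%N).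
have EV n : (`|'E_P[V]| <= (geometric (c * 2) 2^-1 n)%:E)%E.
  apply: le_trans (expectation_norm_le (c20 n) (UV2 n) (UnV n)).
  have -> : 'E_P[V]%E = (- 'E_P[U n - V])%E.
    have := expectationB (Lfun2_Lfun1 (hU n).1) (Lfun2_Lfun1 V2).
    by rewrite (hU n).2 sub0e => ->; rewrite oppeK.
  rewrite abseN expectation.unlock; apply: le_abse_integral => //.
  by apply/measurable_EFinP; exact: measurable_funB.
have V0 : 'E_P[V]%E = 0%E.
  have fV := expectation_fin_num (Lfun2_Lfun1 V2).
  rewrite -(fineK fV); congr EFin; apply/eqP; rewrite -normr_le0.
  by apply: (@le0_of_geometric _ _ (c * 2)) => n; rewrite -lee_fin -abse_EFin fineK.
exists V; split => // n.
rewrite -(@ler_pXn2r _ 2) ?nnegrE ?L2c_norm_ge0// -lee_fin.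
rewrite -L2c_integral_sqr; first exact: UnV.
exact: L2cB.
Qed.

End completeness.

(** * Closed spans and the projection theorem *)

Section closed_span.
Context d (T : measurableType d) (R : realType) (P : probability T R).
Implicit Types (Y Z W : T -> R) (G : set (T -> R)).

Lemma lin_span_gen G g : G g -> lin_span G g.
Proof.
move=> Gg; exists 1%N, (fun=> 1), (fun=> g); split=> //.
by apply/funext => w; rewrite big_ord1 mul1r.
Qed.

Lemma lin_spanZ G k Y : lin_span G Y -> lin_span G (k *: Y).
Proof.
move=> [n [c [g [Gg ->]]]]; exists n, (fun i => k * c i), g; split=> //.
apply/funext => w; transitivity (k * \sum_(i < n) c i * g i w) => //.
by rewrite mulr_sumr; apply: eq_bigr => i _; rewrite mulrA.
Qed.

Lemma lin_spanD G Y Z : lin_span G Y -> lin_span G Z -> lin_span G (Y + Z).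
Proof.
move=> [n [c [g [Gg ->]]]] [m [e [h [Gh ->]]]].
exists (n + m)%N, (fun i => match fintype.split i with inl j => c j | inr j => e j end),
  (fun i => match fintype.split i with inl j => g j | inr j => h j end); split.
  by move=> i; case: fintype.split.
apply/funext => w; rewrite big_split_ord; congr (_ + _); apply: eq_bigr => i _.
  by rewrite (unsplitK (inl i)).
by rewrite (unsplitK (inr i)).
Qed.

Lemma lin_spanS G G' : G `<=` G' -> lin_span G `<=` lin_span G'.
Proof. by move=> sG Y [n [c [g [Gg ->]]]]; exists n, c, g; split => // i; exact: sG. Qed.

Lemma lin_span_sub G (M : set (T -> R)) : M (fun=> 0) ->
  (forall k Y, M Y -> M (k *: Y)) -> (forall Y Z, M Y -> M Z -> M (Y + Z)) ->
  G `<=` M -> lin_span G `<=` M.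
Proof.
move=> M0 MZ MD GM Y [n [c [g [Gg ->]]]].
have -> : (fun w => \sum_(i < n) c i * g i w) = \sum_(i < n) c i *: g i.
  by apply/funext => w; rewrite fct_sumE.
by apply: (big_ind M) => // i _; apply: MZ; exact: GM.
Qed.

Lemma lin_span_L2c G : G `<=` L2c P -> lin_span G `<=` L2c P.
Proof.
by move=> G2; apply: lin_span_sub => //;
  [exact: L2c0|move=> *; exact: L2cZ|exact: L2cD].
Qed.

Section subspace.
Variable G : set (T -> R).
Hypothesis G2 : G `<=` L2c P.

Lemma lin_span_closed_span Y : lin_span G Y -> closed_span P G Y.
Proof.
move=> GY; split; first exact: lin_span_L2c GY.
move=> e e0; exists Y; split=> //.
by rewrite (_ : Y \- Y = fun=> 0) ?/L2c_norm ?cov0l ?sqrtr0//; apply/funext => w;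
  rewrite /= subrr.
Qed.

Lemma closed_span_gen g : G g -> closed_span P G g.
Proof. by move=> Gg; exact/lin_span_closed_span/lin_span_gen. Qed.

Lemma closed_spanD Y Z :
  closed_span P G Y -> closed_span P G Z -> closed_span P G (Y + Z).
Proof.
move=> [Y2 hY] [Z2 hZ]; split; first exact: L2cD.
move=> e e0; have e20 : 0 < e / 2 by rewrite divr_gt0.
have [Y' [sY' eY]] := hY _ e20; have [Z' [sZ' eZ]] := hZ _ e20.
exists (Y' + Z'); split; first exact: lin_spanD.
have [Y'2 Z'2] := (lin_span_L2c G2 sY', lin_span_L2c G2 sZ').
rewrite -[_ \- _]/((Y + Z) - (Y' + Z')) opprD addrACA.
apply: le_lt_trans (ler_L2c_normD (L2cB Y2 Y'2) (L2cB Z2 Z'2)) _.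
by rewrite [ltRHS](splitr e) ltrD.
Qed.

Lemma L2c_normZ k Y : L2c P Y -> L2c_norm P (k *: Y) = `|k| * L2c_norm P Y.
Proof.
move=> hY; rewrite /L2c_norm covZl ?covZr//; last exact: L2cZ.
by rewrite mulrA -expr2 sqrtrM ?sqr_ge0// sqrtr_sqr.
Qed.

Lemma closed_spanZ k Y : closed_span P G Y -> closed_span P G (k *: Y).
Proof.
move=> [Y2 hY]; split; first exact: L2cZ.
move=> e e0; have k0 : 0 < `|k| + 1 by rewrite ltr_wpDl.
have [Y' [sY' eY]] := hY _ (divr_gt0 e0 k0).
exists (k *: Y'); split; first exact: lin_spanZ.
have Y'2 := lin_span_L2c G2 sY'.
rewrite -[_ \- _]/(k *: Y - k *: Y') -scalerBr L2c_normZ; last exact: L2cB.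
move: eY; rewrite ltr_pdivlMr// -[Y \- Y']/(Y - Y').
have := L2c_norm_ge0 P (Y - Y'); have := normr_ge0 k; nra.
Qed.

Lemma closed_spanB Y Z :
  closed_span P G Y -> closed_span P G Z -> closed_span P G (Y - Z).
Proof.
by move=> hY hZ; rewrite -scaleN1r; apply: closed_spanD => //; exact: closed_spanZ.
Qed.

Lemma closed_span_closed Y : L2c P Y ->
  (forall e, 0 < e -> exists Z, closed_span P G Z /\ L2c_norm P (Y - Z) < e) ->
  closed_span P G Y.
Proof.
move=> Y2 hY; split=> // e e0; have e20 : 0 < e / 2 by rewrite divr_gt0.
have [Z [[Z2 hZ] eZ]] := hY _ e20; have [W [sW eW]] := hZ _ e20.
exists W; split=> //; have W2 := lin_span_L2c G2 sW.
apply: le_lt_trans (ler_L2c_normB Y2 W2 Z2) _.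
by rewrite [ltRHS](splitr e) ltrD.
Qed.

Lemma cov_closed_span_eq0 W Y : L2c P W -> (forall g, G g -> cov P W g = 0) ->
  closed_span P G Y -> cov P W Y = 0.
Proof.
move=> W2 Wg [Y2 hY].
have Wlin Z : lin_span G Z -> L2c P Z /\ cov P W Z = 0.
  apply: (@lin_span_sub G (fun Z => L2c P Z /\ cov P W Z = 0)).
  - by split; [exact: L2c0|rewrite covC cov0l].
  - by move=> k Z' [Z'2 Z'0]; split; [exact: L2cZ|rewrite covZr// Z'0 mulr0].
  - by move=> Z1 Z2 [? E1] [? E2]; split; [exact: L2cD|rewrite covDr// E1 E2 addr0].
  - by move=> g Gg; split; [exact: G2|exact: Wg].
apply/eqP; rewrite -normr_le0; apply/ler_addgt0Pl => e e0; rewrite addr0.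
have w0 : 0 < L2c_norm P W + 1 by rewrite ltr_wpDl// L2c_norm_ge0.
have [Z [sZ eZ]] := hY _ (divr_gt0 e0 w0); have [Z2 Z0] := Wlin _ sZ.
have -> : cov P W Y = cov P W (Y - Z) by rewrite covBr// Z0 subr0.
apply: le_trans (ler_cov_norm W2 (L2cB Y2 Z2)) _.
move: eZ; rewrite ltr_pdivlMr// -[Y \- Z]/(Y - Z).
have := L2c_norm_ge0 P (Y - Z); have := L2c_norm_ge0 P W; nra.
Qed.

(** A minimizing sequence with excess at most [4 ^- n] has increments bounded
    by [2 * 2 ^- n], by the parallelogram law, so it has a limit V.  Instead of
    showing that V is a minimizer, the orthogonality relation is obtained in
    the limit: a near-minimizer is nearly orthogonal to the subspace. *)
Theorem orth_projection_exists Y : L2c P Y ->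
  exists Z, is_orth_proj P (closed_span P G) Y Z.
Proof.
move=> Y2; pose M := closed_span P G.
have M2 Z : M Z -> L2c P Z by move=> [].
pose E : set R := [set cov P (Y - Z) (Y - Z) | Z in M].
have E0 : lbound E 0 by move=> _ [Z _ <-]; exact: cov_ge0.
have M0 : M (fun=> 0).
  apply: lin_span_closed_span; exists 0%N, (fun=> 0), (fun=> fun=> 0).
  by split=> [[]//|]; apply/funext => w; rewrite big_ord0.
have infE : has_inf E.
  by split; [exists (cov P (Y - fun=> 0) (Y - fun=> 0)), (fun=> 0)|exists 0].
pose r n : R := geometric 1 2^-1 n.
have r0 n : 0 < r n by rewrite /r /= mul1r exprn_gt0// invr_gt0.
have /choice[Z hZ] n : exists Z, M Z /\ cov P (Y - Z) (Y - Z) < inf E + r n ^+ 2.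
  have [_ [Z MZ <-] hZ] := inf_adherent (exprn_gt0 2 (r0 n)) infE.
  by exists Z.
have infEle W : M W -> inf E <= cov P (Y - W) (Y - W).
  by move=> MW; apply: ge_inf; [exists 0|exists W].
have MZ n := (hZ n).1; have Z2 n := M2 _ (MZ n).
have Zstep n : L2c_norm P (Z n.+1 - Z n) <= geometric 2 2^-1 n.
  rewrite -(@ler_pXn2r _ 2) ?nnegrE ?L2c_norm_ge0//; last first.
    by have := r0 n; rewrite /r /= => h; lra.
  (* parallelogram law: the midpoint of Z n and Z n.+1 is no closer to Y *)
  set A := Y - Z n; set B := Y - Z n.+1.
  have [A2 B2] : L2c P A /\ L2c P B by split; exact: L2cB.
  have := infEle _ (closed_spanZ 2^-1 (closed_spanD (MZ n) (MZ n.+1))).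
  have -> : Y - 2^-1 *: (Z n + Z n.+1) = 2^-1 *: (A + B).
    have half1 : 2^-1 + 2^-1 = 1 :> R by field.
    by rewrite /A /B addrACA -opprD scalerBr [2^-1 *: (Y + Y)]scalerDr -scalerDl
      half1 scale1r.
  have AB2 := L2cD A2 B2; have hAB2 := L2cZ 2^-1 AB2.
  rewrite covZl// covZr// covDl// (covDr A2 B2 A2) (covDr A2 B2 B2) (covC P B A).
  rewrite sqr_L2c_norm; have -> : Z n.+1 - Z n = A - B.
    by rewrite /A /B opprB [RHS]addrC addrA subrK.
  have AB2' := L2cB A2 B2; rewrite covBl// (covBr A2 B2 A2) (covBr A2 B2 B2) (covC P B A).
  have := (hZ n).2; have := (hZ n.+1).2; rewrite -/A -/B.
  have -> : geometric 2 2^-1 n = 2 * r n by rewrite /r /=; ring.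
  have -> : r n.+1 = r n / 2 by rewrite /r /= exprS; field.
  have := sqr_ge0 (r n); rewrite !exprMn; lra.
have [V [V2 hV]] := L2c_complete Z2 Zstep.
have MV : M V.
  apply: closed_span_closed => // e e0.
  have [n hn] : exists n, geometric (2 * 2) 2^-1 n < e.
    apply: contrapT => /forallNP he; have := e0; rewrite ltNge => /negP; apply.
    by apply: (@le0_of_geometric _ _ (2 * 2)) => n; rewrite leNgt; apply/negP.
  exists (Z n); split; first exact: MZ.
  rewrite L2c_normBC//; exact: le_lt_trans hn.
exists V; split=> // W MW; have W2 := M2 _ MW.
have YZW n : `|cov P (Y - Z n) W| <= r n * L2c_norm P W.
  rewrite -(@ler_pXn2r _ 2) ?nnegrE ?mulr_ge0 ?L2c_norm_ge0 ?(ltW (r0 n))//.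
  rewrite real_normK ?num_real// exprMn sqr_L2c_norm.
  apply: quad_ge0_discr (cov_ge0 _ _) _ => t.
  have := infEle _ (closed_spanB (MZ n) (closed_spanZ t MW)).
  have -> : Y - (Z n - t *: W) = (Y - Z n) + t *: W by rewrite opprB addrCA addrC.
  have A2 := L2cB Y2 (Z2 n); have tW := L2cZ t W2.
  have AtW := L2cD A2 tW; rewrite (covDl A2 tW AtW) (covDr A2 tW A2) (covDr A2 tW tW).
  rewrite !covZl// !covZr//.
  by have := (hZ n).2; rewrite (covC P W); lra.
apply/eqP; rewrite -normr_le0.
apply: (@le0_of_geometric _ _ (5 * L2c_norm P W)) => n.
have -> : Y \- V = (Y - Z n) + (Z n - V) by rewrite addrA subrK.
have YZ2 := L2cB Y2 (Z2 n); have ZV2 := L2cB (Z2 n) V2; rewrite covDl//.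
apply: le_trans (ler_normD _ _) _.
have := YZW n; have := ler_cov_norm ZV2 W2; have := hV n; have := L2c_norm_ge0 P W.
have -> : geometric (2 * 2) 2^-1 n = 4 * r n by rewrite /r /=; ring.
have -> : geometric (5 * L2c_norm P W) 2^-1 n = 5 * L2c_norm P W * r n.
  by rewrite /r /=; ring.
nra.
Qed.

End subspace.
End closed_span.

(** * Families with frame bounds: dual family, expansion, partial covariances *)

(** A bound for the linear functional [cov P _ V] extends from the linear span
    to its closure, by continuity. *)
Lemma cov_closed_span_bound d (T : measurableType d) (R : realType)
    (P : probability T R) (G : set (T -> R)) (V Y : T -> R) (c : R) :
  G `<=` L2c P -> L2c P V -> 0 <= c ->
  (forall F, lin_span G F -> `|cov P F V| <= c * L2c_norm P F) ->
  closed_span P G Y -> `|cov P Y V| <= c * L2c_norm P Y.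
Proof.
move=> G2 V2 c0 hF [Y2 hY]; apply/ler_addgt0Pl => e e0.
have k0 : 0 < c + L2c_norm P V + 1 by have := L2c_norm_ge0 P V; lra.
have [F [sF eF]] := hY _ (divr_gt0 e0 k0); have F2 := lin_span_L2c G2 sF.
have -> : cov P Y V = cov P F V + cov P (Y - F) V by rewrite covBl// addrC subrK.
apply: le_trans (ler_normD _ _) _.
have YF2 := L2cB Y2 F2; have := hF _ sF; have := ler_cov_norm YF2 V2.
have := ler_L2c_normD Y2 (L2cB F2 Y2); rewrite addrC subrK (L2c_normBC F2 Y2).
move: eF; rewrite ltr_pdivlMr// -[Y \- F]/(Y - F).
have := L2c_norm_ge0 P (Y - F); have := L2c_norm_ge0 P V.
set a := L2c_norm P (Y - F); set b := L2c_norm P F; set v := L2c_norm P V.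
set y := L2c_norm P Y => v0 a0 ae bya hav hcb.
have : c * b <= c * (y + a) by rewrite ler_wpM2l.
nra.
Qed.

Lemma CauchySchwarz_sum (R : realFieldType) (I : Type) (s : seq I) (f g : I -> R) :
  (\sum_(i <- s) f i * g i) ^+ 2 <=
  (\sum_(i <- s) f i ^+ 2) * \sum_(i <- s) g i ^+ 2.
Proof.
apply: quad_ge0_discr => [|t]; first by apply: sumr_ge0 => i _; exact: sqr_ge0.
have -> : \sum_(i <- s) f i ^+ 2 + 2 * t * \sum_(i <- s) f i * g i +
    t ^+ 2 * \sum_(i <- s) g i ^+ 2 = \sum_(i <- s) (f i + t * g i) ^+ 2.
  by rewrite !mulr_sumr -!big_split; apply: eq_bigr => i _ /=; ring.
by apply: sumr_ge0 => i _; exact: sqr_ge0.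
Qed.

Section riesz_family.
Context d (T : measurableType d) (R : realType) (P : probability T R).
Context (I : choiceType) (X : I -> T -> R).
Implicit Types (i j k : I) (s : seq I) (f g : I -> R) (A : set I).

Definition lincomb s f : T -> R := \sum_(i <- s) f i *: X i.

Lemma eq_lincomb s f g : {in s, f =1 g} -> lincomb s f = lincomb s g.
Proof. by move=> fg; apply: eq_big_seq => i /fg ->. Qed.

Lemma lincombD s f g :
  lincomb s f + lincomb s g = lincomb s (fun i => f i + g i).
Proof. by rewrite -big_split; apply: eq_bigr => i _; rewrite scalerDl. Qed.

Lemma lincombZ (c : R) s f : c *: lincomb s f = lincomb s (fun i => c * f i).
Proof. by rewrite scaler_sumr; apply: eq_bigr => i _; rewrite scalerA. Qed.

Lemma lincomb_widen s s' f : uniq s -> uniq s' -> {subset s <= s'} ->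
  lincomb s f = lincomb s' (fun i => if i \in s then f i else 0).
Proof.
move=> us us' ss'.
have -> : lincomb s' (fun i => if i \in s then f i else 0) =
    \sum_(i <- s' | i \in s) f i *: X i.
  rewrite big_mkcond; apply: eq_bigr => i _; case: ifP => // _.
  by rewrite scale0r.
rewrite -big_filter; apply: perm_big; apply: uniq_perm => //.
  exact: filter_uniq.
by move=> i; rewrite mem_filter; case: (boolP (i \in s)) => // /ss' ->.
Qed.

(** Repeated generators are merged, so that the frame bounds apply. *)
Lemma lin_span_lincomb A Y : lin_span (X @` A) Y ->
  exists s f, [/\ uniq s, {in s, forall i, A i} & Y = lincomb s f].
Proof.
move: Y; apply: (@lin_span_sub _ _ _ _ (fun Y =>
  exists s f, [/\ uniq s, {in s, forall i, A i} & Y = lincomb s f])).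
- by exists [::], (fun=> 0); split; rewrite // /lincomb big_nil.
- move=> k _ [s [f [us sA ->]]]; exists s, (fun i => k * f i).
  by split=> //; rewrite lincombZ.
- move=> _ _ [s [f [us sA ->]]] [s' [f' [us' sA' ->]]].
  exists (undup (s ++ s')), (fun i => (if i \in s then f i else 0) +
    (if i \in s' then f' i else 0)); split; first exact: undup_uniq.
    by move=> i; rewrite mem_undup mem_cat => /orP[/sA|/sA'].
  rewrite -lincombD; congr (_ + _); apply: lincomb_widen;
    rewrite ?undup_uniq// => i iS; by rewrite mem_undup mem_cat iS ?orbT.
- move=> _ [i Ai <-]; exists [:: i], (fun=> 1); split=> //.
    by move=> j; rewrite inE => /eqP ->.
  by rewrite /lincomb big_seq1 scale1r.
Qed.

Hypothesis X2 : forall i, L2c P (X i).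

Let XA2 A : X @` A `<=` L2c P. Proof. by move=> _ [i _ <-]. Qed.

Lemma lincomb_L2c s f : L2c P (lincomb s f).
Proof. by apply: L2c_sum => i _; exact: L2cZ. Qed.

Lemma cov_lincomb s f W : L2c P W ->
  cov P (lincomb s f) W = \sum_(i <- s) f i * cov P (X i) W.
Proof.
move=> W2; rewrite /lincomb cov_suml//; last by move=> i; exact: L2cZ.
by apply: eq_bigr => i _; rewrite covZl.
Qed.

Definition span_off A : set (T -> R) := closed_span P (X @` ~` A).
Definition proj_off A i : T -> R := orth_proj P (span_off A) (X i).
Definition resid_off A i : T -> R := X i - proj_off A i.

Lemma span_off_set0 A : span_off A `<=` span_off set0.
Proof.
move=> Y [Y2 hY]; split=> // e /hY[Z [sZ eZ]]; exists Z; split=> //.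
by apply: lin_spanS sZ => _ [i _ <-]; exists i => // -[].
Qed.

Lemma span_off_gen A i : ~ A i -> span_off A (X i).
Proof. by move=> Ai; apply: closed_span_gen => //; exists i. Qed.

Lemma proj_offP A i : is_orth_proj P (span_off A) (X i) (proj_off A i).
Proof.
have [Z hZ] := orth_projection_exists (XA2 (A := ~` A)) (X2 i).
exact: (@xgetPex _ (fun=> 0) [set Z | is_orth_proj P (span_off A) (X i) Z]
  (ex_intro _ Z hZ)).
Qed.

Lemma proj_off_L2c A i : L2c P (proj_off A i).
Proof. by have [[]] := proj_offP A i. Qed.

Lemma resid_off_L2c A i : L2c P (resid_off A i).
Proof. exact/L2cB/proj_off_L2c. Qed.

Lemma resid_in_span A i : span_off set0 (resid_off A i).
Proof.
apply: closed_spanB => //; first exact: span_off_gen.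
exact: (span_off_set0 (proj_offP A i).1).
Qed.

Lemma res_orth A i W : span_off A W -> cov P (resid_off A i) W = 0.
Proof. exact: (proj_offP A i).2. Qed.

Lemma cov_res_gen A i j :
  cov P (resid_off A i) (X j) = cov P (resid_off A i) (resid_off A j).
Proof.
have rA := resid_off_L2c A i; have pA := proj_off_L2c A j.
by rewrite covBr// (res_orth _ (proj_offP A j).1) subr0.
Qed.

(** An element of the closed span orthogonal to the whole family is orthogonal
    to itself, hence vanishes almost surely. *)
Lemma null_in_span W : span_off set0 W -> (forall i, cov P W (X i) = 0) ->
  forall V, L2c P V -> cov P W V = 0.
Proof.
move=> hW WX V V2; have W2 := hW.1; apply: cov_null => //.
by apply: cov_closed_span_eq0 hW => // _ [i _ <-].
Qed.

Variables (m M : R).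
Hypotheses (m0 : 0 < m) (M0 : 0 <= M).
Hypothesis lower : forall s f, uniq s ->
  m * \sum_(i <- s) f i ^+ 2 <= cov P (lincomb s f) (lincomb s f).
Hypothesis upper : forall s f, uniq s ->
  cov P (lincomb s f) (lincomb s f) <= M * \sum_(i <- s) f i ^+ 2.

Definition res_var i : R := cov P (resid_off [set i] i) (resid_off [set i] i).
Definition dual_family i : T -> R := (res_var i)^-1 *: resid_off [set i] i.

(** Subtracting from [X i] a combination of the other variables leaves a
    combination whose coefficient at [i] is 1, of squared norm at least [m]
    by the lower frame bound; this persists in the limit. *)
Lemma res_var_gt0 i : 0 < res_var i.
Proof.
rewrite /res_var -sqr_L2c_norm exprn_gt0//.
suff : Num.sqrt m <= L2c_norm P (resid_off [set i] i).
  by apply: lt_le_trans; rewrite sqrtr_gt0.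
apply/ler_addgt0Pl => e e0.
have [_ /(_ _ e0)[Z [sZ eZ]]] := (proj_offP [set i] i).1.
have Z2 := lin_span_L2c (XA2 (A := _)) sZ; have p2 := proj_off_L2c [set i] i.
have [s [f [us sA ZE]]] := lin_span_lincomb sZ.
have is' : i \notin s by apply/negP => /sA; apply.
have XZE : X i - Z = lincomb (i :: s) (fun j => if j == i then 1 else - f j).
  rewrite /lincomb big_cons eqxx scale1r ZE /lincomb -sumrN; congr (_ + _).
  apply: eq_big_seq => j js; case: eqP => [ji|_]; last by rewrite scaleNr.
  by rewrite -ji js in is'.
have : Num.sqrt m <= L2c_norm P (X i - Z).
  rewrite /L2c_norm ler_wsqrtr// XZE.
  apply: le_trans (lower _ _); last by rewrite /= is'.
  rewrite big_cons eqxx expr1n ler_peMr ?(ltW m0)// lerDl.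
  by apply: sumr_ge0 => j _; exact: sqr_ge0.
move=> /le_trans; apply; apply: le_trans (ler_L2c_normB (X2 i) Z2 p2) _.
by rewrite addrC lerD2r ltW.
Qed.

Lemma dual_L2c i : L2c P (dual_family i).
Proof. exact/L2cZ/resid_off_L2c. Qed.

Lemma dual_in_span i : span_off set0 (dual_family i).
Proof. by apply: closed_spanZ => //; exact: resid_in_span. Qed.

Lemma cov_gen_dual i j : cov P (X j) (dual_family i) = (j == i)%:R.
Proof.
have rA := resid_off_L2c [set i] i; rewrite covC covZl//.
have [->|ji] := eqVneq j i.
  by rewrite cov_res_gen mulVf// gt_eqF ?res_var_gt0.
by rewrite res_orth ?mulr0//; apply: span_off_gen => /= /eqP; apply/negP.
Qed.

Lemma cov_lincomb_dual s f i : uniq s ->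
  cov P (lincomb s f) (dual_family i) = if i \in s then f i else 0.
Proof.
move=> us; rewrite cov_lincomb; last exact: dual_L2c.
under eq_bigr do rewrite cov_gen_dual.
case: ifP => is'.
  rewrite (big_rem i)//= eqxx mulr1 big_seq big1 ?addr0// => j.
  by rewrite mem_rem_uniq// inE => /andP[/negPf-> _]; rewrite mulr0.
rewrite big_seq big1// => j js; case: eqP => [ji|_]; last by rewrite mulr0.
by rewrite -ji js in is'.
Qed.

(** Write q for the sum and V for the combination of the dual elements with
    coefficients [cov P W (dual_family i)], so that [cov P W V = q].  On a
    finite combination F the pairing [cov P F V] involves only the coefficients
    of F, so it is at most [Num.sqrt (q / m)] times the norm of F.  This bound
    extends to [W] and reads q <= sqrt (q / m) |W|. *)
Lemma bessel_dual W s : span_off set0 W -> uniq s ->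
  m * \sum_(i <- s) cov P W (dual_family i) ^+ 2 <= cov P W W.
Proof.
move=> hW us; pose a i := cov P W (dual_family i).
set q := \sum_(i <- s) _.
have q0 : 0 <= q by apply: sumr_ge0 => i _; exact: sqr_ge0.
pose V := \sum_(i <- s) a i *: dual_family i.
have V2 : L2c P V by apply: L2c_sum => i _; exact/L2cZ/dual_L2c.
have covV F : L2c P F -> cov P F V = \sum_(i <- s) a i * cov P F (dual_family i).
  move=> F2; rewrite covC cov_suml//; last by move=> i; exact/L2cZ/dual_L2c.
  by apply: eq_bigr => i _; rewrite covZl// 1?covC//; exact: dual_L2c.
have qE : cov P W V = q by rewrite covV//; exact: hW.1.
have VF F : lin_span (X @` ~` set0) F ->
    `|cov P F V| <= Num.sqrt (q / m) * L2c_norm P F.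
  move=> sF; have F2 := lin_span_L2c (XA2 (A := _)) sF.
  have [s' [f [us' _ FE]]] := lin_span_lincomb sF.
  have sub : \sum_(i <- s) cov P F (dual_family i) ^+ 2 <= \sum_(i <- s') f i ^+ 2.
    rewrite FE; under eq_bigr do rewrite cov_lincomb_dual//.
    have -> : \sum_(i <- s) (if i \in s' then f i else 0) ^+ 2 =
        \sum_(i <- [seq i <- s | i \in s']) f i ^+ 2.
      rewrite big_filter [RHS]big_mkcond; apply: eq_bigr => i _.
      by case: ifP; rewrite ?expr0n.
    have -> : \sum_(i <- s') f i ^+ 2 =
        \sum_(i <- [seq i <- s' | i \in s]) f i ^+ 2 +
        \sum_(i <- s' | i \notin s) f i ^+ 2.
      by rewrite big_filter [LHS](bigID (mem s)).

    rewrite (perm_big [seq i <- s' | i \in s])/=.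
      by rewrite lerDl; apply: sumr_ge0 => i _; exact: sqr_ge0.
    apply: uniq_perm; rewrite ?filter_uniq// => i.
    by rewrite !mem_filter andbC.
  rewrite -(@ler_pXn2r _ 2) ?nnegrE ?mulr_ge0 ?sqrtr_ge0 ?L2c_norm_ge0//.
  rewrite real_normK ?num_real// exprMn sqr_sqrtr ?divr_ge0 ?(ltW m0)//.
  rewrite sqr_L2c_norm covV// -mulrA.
  apply: le_trans (CauchySchwarz_sum _ _ _) _; rewrite ler_wpM2l//.
  rewrite ler_pdivlMl//; apply: le_trans (ler_wpM2l (ltW m0) sub) _.
  by rewrite FE; exact: lower.
have := cov_closed_span_bound (XA2 (A := _)) V2 (sqrtr_ge0 _) VF hW.
rewrite qE ger0_norm// -(@ler_pXn2r _ 2) ?nnegrE ?mulr_ge0 ?sqrtr_ge0 ?L2c_norm_ge0//.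
rewrite exprMn sqr_sqrtr ?divr_ge0 ?(ltW m0)// sqr_L2c_norm expr2 -mulrA.
move: q0; rewrite le_eqVlt => /orP[/eqP<- _|q0]; first by rewrite mulr0 cov_ge0.
by rewrite ler_pM2l// ler_pdivlMl.
Qed.

(** Partial sums reproduce a finite combination once all its indices are
    included, and by [bessel_dual] and the upper frame bound they are uniformly
    bounded operators; so convergence extends to the closure.  Arbitrary finite
    index sets containing [s0] are allowed, hence any order of summation. *)
Lemma dual_expansion Y e : span_off set0 Y -> 0 < e ->
  exists s0, forall s, uniq s -> {subset s0 <= s} ->
    L2c_norm P (Y - lincomb s (fun i => cov P Y (dual_family i))) < e.
Proof.
move=> hY e0; pose k := Num.sqrt (M / m).
have k0 : 0 <= k by exact: sqrtr_ge0.
have k1 : 0 < 1 + k by rewrite ltr_wpDr.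
have Y2 := hY.1; have [F [sF eF]] := hY.2 _ (divr_gt0 e0 k1).
have [s0 [f [us0 _ FE]]] := lin_span_lincomb sF; exists s0 => s us s0s.
have F2 : L2c P F by rewrite FE; exact: lincomb_L2c.
have hF : span_off set0 F by exact: (lin_span_closed_span (XA2 (A := _)) sF).
have FE' : F = lincomb s (fun i => cov P F (dual_family i)).
  rewrite {1}FE (lincomb_widen _ us0 us s0s); apply: eq_lincomb => i _.
  by rewrite FE cov_lincomb_dual.
pose S W := lincomb s (fun i => cov P W (dual_family i)).
have hYF := closed_spanB (XA2 (A := _)) hY hF.
have SB : Y - S Y = (Y - F) - S (Y - F).
  have -> : S (Y - F) = S Y - F.
    have NF : - F = lincomb s (fun i => -1 * cov P F (dual_family i)).
      by rewrite -lincombZ -FE' scaleN1r.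
    rewrite [X in _ = _ + X]NF lincombD; apply: eq_lincomb => i _.
    by rewrite mulN1r covBl//; exact: dual_L2c.
  by rewrite opprB addrA subrK.
have Sle : L2c_norm P (S (Y - F)) <= k * L2c_norm P (Y - F).
  rewrite -(@ler_pXn2r _ 2) ?nnegrE ?mulr_ge0 ?L2c_norm_ge0//.
  rewrite exprMn !sqr_L2c_norm sqr_sqrtr ?divr_ge0 ?(ltW m0)//.
  apply: le_trans (upper _ us) _; rewrite -mulrA ler_wpM2l//.
  by rewrite ler_pdivlMl//; exact: bessel_dual.
rewrite -/(S Y) SB; have YF2 := L2cB Y2 F2.
apply: le_lt_trans (ler_L2c_normD YF2 (L2cN (lincomb_L2c _ _))) _.
rewrite L2c_normN; last exact: lincomb_L2c.
move: eF; rewrite ltr_pdivlMr// -[Y \- F]/(Y - F).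
by move: Sle; rewrite /S; lra.
Qed.

(** The Gram matrix of the dual family, that is, the inverse of the Gram matrix
    [cov P (X i) (X j)]. *)
Definition gram i j : R := cov P (dual_family i) (dual_family j).

Lemma gramC i j : gram i j = gram j i.
Proof. by rewrite /gram covC. Qed.

Lemma gram_diag i : gram i i = (res_var i)^-1.
Proof.
have r2 := resid_off_L2c [set i] i.
rewrite /gram covZl ?covZr//; last exact: dual_L2c.
by rewrite -/(res_var i) mulVf ?mulr1// gt_eqF ?res_var_gt0.
Qed.

Lemma gram_diag_gt0 i : 0 < gram i i.
Proof. by rewrite gram_diag invr_gt0 res_var_gt0. Qed.

Lemma cov_proj_dual A i j : A j -> cov P (proj_off A i) (dual_family j) = 0.
Proof.
move=> Aj; rewrite covC; apply: cov_closed_span_eq0 (proj_offP A i).1 => //.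
  exact: dual_L2c.
move=> _ [k Ak <-]; rewrite covC cov_gen_dual.
by case: eqP => // kj; case: Ak; rewrite kj.
Qed.

Lemma cov_res_dual A i j : A j -> cov P (resid_off A i) (dual_family j) = (i == j)%:R.
Proof.
move=> Aj; rewrite covBl ?cov_proj_dual ?subr0 ?cov_gen_dual//.
  exact: proj_off_L2c.
exact: dual_L2c.
Qed.

Lemma cov_proj1_dual i j : i != j ->
  cov P (proj_off [set i] i) (dual_family j) = - (res_var i * gram i j).
Proof.
move=> ij; have r2 := resid_off_L2c [set i] i; have d2 := dual_L2c j.
have p2 := proj_off_L2c [set i] i.
rewrite /gram covZl// mulVKf ?gt_eqF ?res_var_gt0//.
by rewrite covBl// cov_gen_dual (negPf ij) sub0r opprK.
Qed.

(** The difference of the residual and the stated combination of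
    [dual_family i] and [dual_family j] lies in the closed span and is
    orthogonal to every [X l], so it vanishes almost surely. *)
Lemma res_pair_dual i j k : i != j -> let A := [set i; j] in
  cov P (resid_off A i) (dual_family k) =
    cov P (resid_off A i) (resid_off A i) * gram i k +
    cov P (resid_off A i) (resid_off A j) * gram j k.
Proof.
move=> ij A; set a := cov P _ (resid_off A i); set b := cov P _ (resid_off A j).
have [ri di dj] := And3 (resid_off_L2c A i) (dual_L2c i) (dual_L2c j).
have [ai bj] := (L2cZ a di, L2cZ b dj); have ab := L2cD ai bj.
pose E := resid_off A i - (a *: dual_family i + b *: dual_family j).
have hE : span_off set0 E.
  apply: closed_spanB => //; first exact: resid_in_span.
  by apply: closed_spanD => //; apply: closed_spanZ => //; exact: dual_in_span.
have EX l : cov P E (X l) = 0.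
  rewrite (covBl ri ab (X2 l)) (covDl ai bj (X2 l)) (covZl a di (X2 l)).
  rewrite (covZl b dj (X2 l)) !(covC P (dual_family _)) !cov_gen_dual.
  have [->|li] := eqVneq l i.
    by rewrite cov_res_gen -/a (negPf ij) mulr1 mulr0 addr0 subrr.
  have [->|lj] := eqVneq l j.
    by rewrite cov_res_gen -/b mulr1 mulr0 add0r subrr.
  rewrite res_orth ?mulr0 ?addr0 ?subr0//; apply: span_off_gen.
  by move=> [] /= /eqP; apply/negP.
have d2 := dual_L2c k; have := null_in_span hE EX d2.
rewrite (covBl ri ab d2) (covDl ai bj d2) (covZl a di d2) (covZl b dj d2).
by move=> /eqP; rewrite subr_eq0 => /eqP.
Qed.

(** Pairing [res_pair_dual] with [dual_family i] and [dual_family j] gives the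
    first row of the equation saying that the covariance matrix of the two
    residuals is the inverse of the 2 x 2 Gram matrix; Cramer's rule solves it.
    The determinant is positive because its product with a nonnegative number
    is [gram j j]. *)
Theorem partial_cov_gram i j : i != j -> let A := [set i; j] in
  0 < gram i i * gram j j - gram i j ^+ 2 /\
  cov P (resid_off A i) (resid_off A j) =
    - gram i j / (gram i i * gram j j - gram i j ^+ 2).
Proof.
move=> ij A; have := res_pair_dual i ij; have := res_pair_dual j ij.
have [Ai Aj] : A i /\ A j by split; [left|right].
rewrite /= -/A (cov_res_dual _ Ai) (cov_res_dual _ Aj) eqxx (negPf ij)/=.
rewrite (gramC j i); have := cov_ge0 P (resid_off A i); have := gram_diag_gt0 j.
move: (cov P (resid_off A i) (resid_off A i)) (cov P (resid_off A i) (resid_off A j)).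
move: (gram i i) (gram i j) (gram j j) => x y z a b.
move=> z0 a0 e0 e1.
have det : a * (x * z - y ^+ 2) = z.
  have -> : a * (x * z - y ^+ 2) = z * (a * x + b * y) - y * (a * y + b * z) by ring.
  by rewrite -e0 -e1; ring.
have det0 : 0 < x * z - y ^+ 2.
  rewrite ltNge; apply/negP => h; move: z0; rewrite -det ltNge => /negP; apply.
  by rewrite mulr_ge0_le0.
split=> //; apply: (mulIf (lt0r_neq0 det0)); rewrite mulfVK ?gt_eqF//.
have -> : b * (x * z - y ^+ 2) = x * (a * y + b * z) - y * (a * x + b * y) by ring.
by rewrite -e0 -e1; ring.
Qed.
End riesz_family.

(** * Sums over the integers and over finitely supported vectors *)

Lemma big_uniq_support (V : nmodType) (I : eqType) (s s' : seq I) (F : I -> V) :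
  uniq s -> uniq s' -> {subset s <= s'} ->
  (forall i, i \notin s -> F i = 0) ->
  \sum_(i <- s') F i = \sum_(i <- s) F i.
Proof.
move=> us us' ss' F0; rewrite (bigID (mem s))/= [X in _ + X]big1// addr0.
rewrite -big_filter; apply: perm_big; apply: uniq_perm => //.
  exact: filter_uniq.
by move=> i; rewrite mem_filter /=; case: (boolP (i \in s)) => // /ss' ->.
Qed.

Definition boxZ (n : nat) : seq int := [seq k%:Z - n%:Z | k <- iota 0 n.*2.+1].

Lemma mem_boxZ n t : (t \in boxZ n) = (`|t| <= n)%N.
Proof.
apply/mapP/idP => [[k]|tn]; first by rewrite mem_iota => kn ->; lia.
by exists (absz (t + n%:Z)); [rewrite mem_iota; lia|lia].
Qed.

Lemma boxZ_uniq n : uniq (boxZ n).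
Proof. by rewrite map_inj_uniq ?iota_uniq// => k l; lia. Qed.

Lemma psumZE (V : nmodType) (f : int -> V) n :
  psumZ f n = \sum_(t <- boxZ n) f t.
Proof.
rewrite /psumZ /boxZ big_map (_ : iota 0 n.*2.+1 = index_iota 0 n.*2.+1).
  by rewrite big_mkord.
by rewrite /index_iota subn0.
Qed.

Lemma eventually_boxZ (s : seq int) : exists N, forall n, (N <= n)%N ->
  {subset s <= boxZ n}.
Proof.
exists (\max_(t <- s) `|t|)%N => n Nn t ts; rewrite mem_boxZ.
by apply: leq_trans Nn; exact: leq_bigmax_seq.
Qed.

Lemma sumZ_support (R : realType) (f : int -> R[i]) (s : seq int) : uniq s ->
  (forall t, t \notin s -> f t = 0) -> sumZ f = \sum_(t <- s) f t.
Proof.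
move=> us f0; have [N hN] := eventually_boxZ s.
apply: (@lim_near_cst (R[i] : numFieldType)); first exact: norm_hausdorff.
exists N => // n /= Nn.
by rewrite psumZE; apply: big_uniq_support => //; [exact: boxZ_uniq|exact: hN].
Qed.

Section box_indices.
Variable p : nat.
Definition box_indices (l : seq int) : seq (int * 'I_p) :=
  [seq (t, b) | t <- l, b <- enum 'I_p].

Lemma mem_box l i : (i \in box_indices l) = (i.1 \in l).
Proof.
case: i => t b /=; apply/allpairsP/idP => [[[u c] [/= ul _ [-> _]]]//|tl].
by exists (t, b); rewrite mem_enum.
Qed.

Lemma box_uniq l : uniq l -> uniq (box_indices l).
Proof.
by move=> ul; apply: allpairs_uniq; rewrite ?enum_uniq// => -[? ?] [? ?] _ _ [-> ->].
Qed.

Lemma big_box (V : nmodType) (F : int * 'I_p -> V) l :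
  \sum_(i <- box_indices l) F i = \sum_(t <- l) \sum_(b < p) F (t, b).
Proof.
rewrite big_allpairs; apply: eq_bigr => t _.
by rewrite big_enum.
Qed.

Lemma sumZ_pairs_support (R : realType) (F : int * 'I_p -> R[i]) s : uniq s ->
  (forall i, i \notin s -> F i = 0) ->
  \sum_(b < p) sumZ (fun t => F (t, b)) = \sum_(i <- s) F i.
Proof.
move=> us F0; pose l := undup [seq i.1 | i <- s].
have ul : uniq l by exact: undup_uniq.
have sl i : i \in s -> i.1 \in l.
  by move=> is'; rewrite mem_undup; apply/mapP; exists i.
have lF (b : 'I_p) t : t \notin l -> F (t, b) = 0.
  by move=> tl; apply: F0; apply: contra tl => /sl.
under eq_bigr do rewrite (sumZ_support ul (lF _)).
rewrite exchange_big -big_box; apply: big_uniq_support => //.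
  exact: box_uniq.
by move=> i is'; rewrite mem_box sl.
Qed.
End box_indices.

Lemma l2_support (R : realType) (u : int -> R[i]) (s : seq int) :
  (forall t, t \notin s -> u t = 0) -> l2 u.
Proof.
move=> u0; rewrite /l2.
rewrite (_ : \esum_(t in [set: int]) _ =
  \esum_(t in [set` s]) ((Normc.normc (u t)) ^+ 2)%:E)%E; last first.
  rewrite [RHS]esum_mkcond; apply: eq_esum => t _; case: ifPn => // ts.
  rewrite u0 ?Normc.normc0 ?expr0n//.
  by apply: contra ts => ts; rewrite inE.
have fs : finite_set [set` s] by exact: finite_seq.
rewrite esum_fset//; last by move=> t _; rewrite lee_fin sqr_ge0.
rewrite fsbig_finite//=; apply: lte_sum_pinfty => t _; exact: ltry.
Qed.

(** * The coefficients and the partial covariances of the time series *)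

(** Cross-multiplication gives [(x - y) * (K + x * y) = 0], and [K + x * y] is
    positive because both squares are below [K]. *)
Lemma ratio_inj (R : realFieldType) (K x y : R) : 0 < K - x ^+ 2 ->
  0 < K - y ^+ 2 -> - x / (K - x ^+ 2) = - y / (K - y ^+ 2) -> x = y.
Proof.
move=> Kx Ky /eqP; rewrite eqr_div ?lt0r_neq0// => /eqP E.
have : (x - y) * (K + x * y) = 0.
  have -> : (x - y) * (K + x * y) = x * (K - y ^+ 2) - y * (K - x ^+ 2) by ring.
  by move: E; rewrite !mulNr => /oppr_inj ->; rewrite subrr.
move=> /eqP; rewrite mulf_eq0 => /orP[|/eqP Kxy]; first by rewrite subr_eq0 => /eqP.
by have := sqr_ge0 (x + y); rewrite sqrrD; lra.
Qed.

Section frame.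
Context d (T : measurableType d) (R : realType) (P : probability T R).
Context (p : nat) (X : int -> 'I_p -> {RV P >-> R}).
Hypothesis X_L2 : forall t a, (X t a : T -> R) \in Lfun P 2%:E.
Hypothesis X_centred : forall t a, 'E_P[X t a]%E = 0%E.

Definition flat_family (i : int * 'I_p) : T -> R := X i.1 i.2.

Lemma flat_L2c i : L2c P (flat_family i).
Proof. by split; [exact: X_L2|exact: X_centred]. Qed.

(** The finitely supported vector of l_{2,p} with the coefficients [f] on [s]:
    the test vectors on which the numerical range is evaluated. *)
Definition zero_ext (s : seq (int * 'I_p)) (f : int * 'I_p -> R)
  (b : 'I_p) (t : int) : R[i] := if (t, b) \in s then (f (t, b))%:C%C else 0.

Lemma zero_ext_l2p s f : l2p (zero_ext s f).
Proof.
move=> b; apply: (@l2_support _ _ [seq i.1 | i <- s]) => t tl.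
rewrite /zero_ext ifN//; apply: contra tl => ts; apply/mapP.
by exists (t, b).
Qed.

Lemma block_act_zero_ext s f a t : uniq s ->
  block_act (Cop X) (zero_ext s f) a t =
    (cov P (flat_family (t, a)) (lincomb flat_family s f))%:C%C.
Proof.
move=> us.
pose F (j : int * 'I_p) : R[i] :=
  (Cop X a j.2 t j.1)%:C%C * (if j \in s then (f j)%:C%C else 0).
rewrite [LHS](@sumZ_pairs_support p R F s us); last first.
  by move=> j js; rewrite /F (negPf js) mulr0.
rewrite covC cov_lincomb//; [|exact: flat_L2c..].
rewrite rmorph_sum; apply: eq_big_seq => j js.
by rewrite /F js -rmorphM /Cop mxE covC mulrC.
Qed.

Lemma inner_zero_ext s f (w : int * 'I_p -> R) : uniq s ->
  l2p_inner (zero_ext s f) (fun b t => (w (t, b))%:C%C) =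
    (\sum_(i <- s) f i * w i)%:C%C.
Proof.
move=> us.
pose F (j : int * 'I_p) : R[i] :=
  (if j \in s then (f j)%:C%C else 0)^* * (w j)%:C%C.
rewrite [LHS](@sumZ_pairs_support p R F s us); last first.
  by move=> j js; rewrite /F (negPf js) conjC0 mul0r.
rewrite rmorph_sum; apply: eq_big_seq => j js.
by rewrite /F js rmorphM; congr (_ * _); exact: conjc_real.
Qed.


Lemma l2p_norm_zero_ext s f : uniq s ->
  l2p_norm (zero_ext s f) = Num.sqrt (\sum_(i <- s) f i ^+ 2).
Proof.
move=> us; rewrite /l2p_norm; congr Num.sqrt.
have -> : zero_ext s f = fun b t => (if (t, b) \in s then f (t, b) else 0)%:C%C.
  by apply/funext => b; apply/funext => t; rewrite /zero_ext; case: ifP.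
have := inner_zero_ext f (fun i => if i \in s then f i else 0) us.
have -> : zero_ext s f = fun b t => (if (t, b) \in s then f (t, b) else 0)%:C%C.
  by apply/funext => b; apply/funext => t; rewrite /zero_ext; case: ifP.
move=> -> /=; apply: eq_big_seq => i is'.
by rewrite is' expr2.
Qed.

Lemma quadratic_form_zero_ext s f : uniq s ->
  complex.Re (l2p_inner (zero_ext s f) (block_act (Cop X) (zero_ext s f))) =
    cov P (lincomb flat_family s f) (lincomb flat_family s f).
Proof.
move=> us; have -> : block_act (Cop X) (zero_ext s f) =
    fun b t => (cov P (flat_family (t, b)) (lincomb flat_family s f))%:C%C.
  by apply/funext => b; apply/funext => t; exact: block_act_zero_ext.
have := inner_zero_ext f
  (fun i => cov P (flat_family i) (lincomb flat_family s f)) us.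
move=> ->; rewrite /=.
by rewrite cov_lincomb//; [exact: flat_L2c|exact/lincomb_L2c/flat_L2c].
Qed.

(** Finitely supported real vectors suffice: on them the form is the squared
    norm of a finite combination of the variables.  The general case follows
    from unit vectors by homogeneity. *)
Lemma frame_bounds :
  (0 < lambda_inf (Cop X))%E ->
  (lambda_inf (Cop X) <= lambda_sup (Cop X))%E ->
  (lambda_sup (Cop X) < +oo)%E ->
  exists m M : R, [/\ 0 < m, 0 <= M,
    forall s f, uniq s -> m * \sum_(i <- s) f i ^+ 2 <=
      cov P (lincomb flat_family s f) (lincomb flat_family s f) &
    forall s f, uniq s -> cov P (lincomb flat_family s f) (lincomb flat_family s f) <=
      M * \sum_(i <- s) f i ^+ 2].
Proof.
have lamI v : l2p_sphere v -> (lambda_inf (Cop X) <=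
    (complex.Re (l2p_inner v (block_act (Cop X) v)))%:E)%E.
  by move=> hv; apply: ereal_inf_lbound; exists v.
have lamS v : l2p_sphere v -> ((complex.Re (l2p_inner v (block_act (Cop X) v)))%:E
    <= lambda_sup (Cop X))%E.
  by move=> hv; apply: ereal_sup_ubound; exists v.
move: lamI lamS.
case: (lambda_inf _) => [m| |] // lamI lamS m0 le_inf_sup; last first.
  by move: le_inf_sup; rewrite leye_eq => /eqP ->.
move: lamS le_inf_sup; case: (lambda_sup _) => [M| |] // lamS.
rewrite lee_fin => mM _; rewrite lte_fin in m0.
have unit s f : uniq s -> \sum_(i <- s) f i ^+ 2 = 1 ->
    m <= cov P (lincomb flat_family s f) (lincomb flat_family s f) <= M.
  move=> us f1; have sph : l2p_sphere (zero_ext s f).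
    by split; [exact: zero_ext_l2p|rewrite l2p_norm_zero_ext// f1 sqrtr1].
  by have := lamI _ sph; have := lamS _ sph; rewrite quadratic_form_zero_ext//
    !lee_fin => -> ->.
have scaled s f : uniq s -> m * \sum_(i <- s) f i ^+ 2 <=
    cov P (lincomb flat_family s f) (lincomb flat_family s f) <=
    M * \sum_(i <- s) f i ^+ 2.
  move=> us; set S := \sum_(i <- s) _.
  have S0 : 0 <= S by apply: sumr_ge0 => i _; exact: sqr_ge0.
  move: (S0); rewrite le_eqVlt => /orP[/eqP SE|Spos].
    have -> : lincomb flat_family s f = fun=> 0.
      rewrite /lincomb big_seq big1// => i is'.
      have fi : f i ^+ 2 <= S.
        rewrite /S (big_rem i)//= lerDl; apply: sumr_ge0 => j _; exact: sqr_ge0.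
      have : f i ^+ 2 = 0 by apply/le_anti; rewrite sqr_ge0 andbT SE.
      by move=> /eqP; rewrite sqrf_eq0 => /eqP ->; rewrite scale0r.
    by rewrite cov0l -SE !mulr0 lexx.
  have rS : 0 < Num.sqrt S by rewrite sqrtr_gt0.
  pose g i := (Num.sqrt S)^-1 * f i.
  have := unit s g us; rewrite /g -lincombZ.
  have L2 := lincomb_L2c flat_L2c s f; rewrite covZl ?covZr//; last exact: L2cZ.
  under eq_bigr do rewrite exprMn.
  rewrite -mulr_sumr -/S exprVn sqr_sqrtr// mulVf ?gt_eqF// => /(_ erefl).
  rewrite mulrA -expr2 exprVn sqr_sqrtr// ler_pdivlMl// ler_pdivrMl//.
  by rewrite mulrC [S * M]mulrC.
exists m, M; split => //; first by apply: le_trans mM; exact: ltW.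
  by move=> s f us; have /andP[] := scaled s f us.
by move=> s f us; have /andP[] := scaled s f us.
Qed.

Section identification.
Variables (m M : R).
Hypotheses (m0 : 0 < m) (M0 : 0 <= M).
Hypothesis lower : forall s f, uniq s -> m * \sum_(i <- s) f i ^+ 2 <=
  cov P (lincomb flat_family s f) (lincomb flat_family s f).
Hypothesis upper : forall s f, uniq s ->
  cov P (lincomb flat_family s f) (lincomb flat_family s f) <= M * \sum_(i <- s) f i ^+ 2.

Let flat2 := flat_L2c.
Let dual2 := dual_L2c flat2.

Lemma psumZ_lincomb (w : int -> 'I_p -> R) n :
  (fun x => psumZ (fun tau => \sum_(b < p) w tau b * X tau b x) n) =
  lincomb flat_family (box_indices p (boxZ n)) (fun i => w i.1 i.2).
Proof.
apply/funext => x; rewrite psumZE /lincomb big_box fct_sumE.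
by apply: eq_bigr => t _; rewrite fct_sumE.
Qed.

(** The boxes of indices [(tau, b)] with [|tau| <= n] exhaust the index set, so
    the expansion of the projection on the dual family converges along them. *)
Lemma is_beta_dual t a :
  is_beta X t a (fun tau b => cov P (proj_off P flat_family [set (t, a)] (t, a))
                                (dual_family P flat_family (tau, b))).
Proof.
split; first exact: (cov_proj_dual flat2 m0 lower).
apply/cvgr0Pnorm_lt => e e0.
have hp := span_off_set0 (proj_offP flat2 [set (t, a)] (t, a)).1.
have [s0 hs0] := dual_expansion flat2 m0 M0 lower upper hp e0.
have [N hN] := eventually_boxZ [seq i.1 | i <- s0].
exists N => // n /= Nn; rewrite ger0_norm ?L2c_norm_ge0// psumZ_lincomb.
rewrite (@eq_lincomb _ _ _ _ _ _ _ (fun i =>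
  cov P (proj_off P flat_family [set (t, a)] (t, a))
        (dual_family P flat_family i))); last by move=> -[].
apply: hs0; first exact/box_uniq/boxZ_uniq.
move=> i is0; rewrite mem_box; apply: hN => //; apply/mapP; by exists i.
Qed.

(** The covariance with [dual_family (tau, b)] is continuous and picks the
    coefficient at [(tau, b)] from every partial sum that contains it. *)
Lemma is_beta_unique t a w tau b : is_beta X t a w ->
  w tau b = cov P (proj_off P flat_family [set (t, a)] (t, a))
                  (dual_family P flat_family (tau, b)).
Proof.
move=> [_ cw]; set Y := proj_off _ _ _ _; set Z := dual_family _ _ _.
have Y2 : L2c P Y by exact: proj_off_L2c.
have Z2 : L2c P Z by exact: dual2.
apply/esym/eqP; rewrite -subr_eq0 -normr_le0.
have cw' : (fun n => L2c_norm P (Y - lincomb flat_family (box_indices p (boxZ n))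
    (fun i => w i.1 i.2)) * L2c_norm P Z) @ \oo --> (0 : R).
  rewrite -(mul0r (L2c_norm P Z)); apply: cvgMl.
  by move: cw; under eq_fun do rewrite psumZ_lincomb.
apply: (cvgr_to_ge cw'); exists `|tau|%N => // n /= taun.
have L2 := lincomb_L2c flat2 (box_indices p (boxZ n)) (fun i => w i.1 i.2).
have -> : cov P Y Z - w tau b =
    cov P (Y - lincomb flat_family (box_indices p (boxZ n)) (fun i => w i.1 i.2)) Z.
  rewrite covBl// (cov_lincomb_dual flat2 m0 lower) ?mem_box ?mem_boxZ ?taun//.
  exact/box_uniq/boxZ_uniq.
by apply: ler_cov_norm => //; exact: L2cB.
Qed.

Lemma betaE t a tau b :
  beta X t a tau b =
    cov P (proj_off P flat_family [set (t, a)] (t, a))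
          (dual_family P flat_family (tau, b)).
Proof.
apply: is_beta_unique.
exact: (@xgetPex _ (fun _ _ => 0) [set w | is_beta X t a w]
  (ex_intro _ _ (is_beta_dual t a))).
Qed.

Lemma sigma2E a t : sigma2 X a t = res_var P flat_family (t, a).
Proof.
have r2 := resid_off_L2c flat2 [set (t, a)] (t, a).
by rewrite /res_var /sigma2 -[RHS]/(fine (_%:E)) covE.
Qed.

Lemma DopE a b t tau : Dop X a b t tau = gram P flat_family (t, a) (tau, b).
Proof.
have G := res_var_gt0 flat2 m0 lower (t, a).
rewrite /Dop sigma2E; case: eqP => [[-> ->]|ne].
  by rewrite (gram_diag flat2 m0 lower).
have ij : (t, a) != (tau, b) by apply/eqP => -[tt ab]; case: ne; rewrite tt ab.
rewrite betaE (cov_proj1_dual flat2 m0 lower ij) opprK mulrC mulKf//.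
by rewrite gt_eqF.
Qed.

Lemma pcovE a b t tau :
  pcov X a b t tau = cov P (resid_off P flat_family [set (t, a); (tau, b)] (t, a))
                           (resid_off P flat_family [set (t, a); (tau, b)] (tau, b)).
Proof. by []. Qed.

Lemma pcov_diag a t : pcov X a a t t = (Dop X a a t t)^-1.
Proof.
rewrite pcovE DopE (gram_diag flat2 m0 lower) invrK.
by rewrite (_ : [set (t, a); (t, a)] = [set (t, a)])// setUid.
Qed.

Lemma pcov_offdiag a b t tau : (t, a) != (tau, b) ->
  0 < Dop X a a t t * Dop X b b tau tau - Dop X a b t tau ^+ 2 /\
  pcov X a b t tau = - Dop X a b t tau /
    (Dop X a a t t * Dop X b b tau tau - Dop X a b t tau ^+ 2).
Proof. by rewrite pcovE !DopE => /(partial_cov_gram flat2 m0 lower). Qed.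

Lemma DopC a b t tau : Dop X a b t tau = Dop X b a tau t.
Proof. by rewrite !DopE gramC. Qed.

Lemma pcovC a b t tau : pcov X a b t tau = pcov X b a tau t.
Proof. by rewrite !pcovE covC setUC. Qed.

Lemma pcov_diag_eq a t t' :
  pcov X a a t t = pcov X a a t' t' <-> Dop X a a t t = Dop X a a t' t'.
Proof. by rewrite !pcov_diag; split=> [/invr_inj|->]. Qed.

Lemma pcov_pair_eq a b t tau t' tau' :
  (t, a) != (tau, b) -> (t', a) != (tau', b) ->
  Dop X a a t t = Dop X a a t' t' ->
  Dop X b b tau tau = Dop X b b tau' tau' ->
  pcov X a b t tau = pcov X a b t' tau' <-> Dop X a b t tau = Dop X a b t' tau'.
Proof.
move=> /pcov_offdiag[d0 ->] /pcov_offdiag[d0' ->] Ea Eb.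
rewrite Ea Eb in d0 *; split=> [|->//]; exact: ratio_inj.
Qed.

Lemma pcov_eq0 a b t tau : (t, a) != (tau, b) ->
  pcov X a b t tau = 0 <-> Dop X a b t tau = 0.
Proof.
move=> /pcov_offdiag[d0 ->]; split=> [/eqP|->]; last by rewrite oppr0 mul0r.
by rewrite mulf_eq0 oppr_eq0 invr_eq0 (gt_eqF d0) orbF => /eqP.
Qed.

(** Off the diagonal the entries at [(t, tau)] and [(0, t - tau)] are
    transferred by [pcov_pair_eq]; the lags [t - tau] and [tau - t] that occur
    there are exchanged by the symmetry of D. *)
Lemma toeplitz_Dop_node a : toeplitz (Dop X a a) <->
  (forall t tau, pcov X a a t tau = pcov X a a 0 (t - tau)).
Proof.
have offdiag (t tau : int) : t != tau -> (t, a) != (tau, a) /\ (0, a) != (t - tau, a).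
  by move=> tt; rewrite !xpair_eqE !eqxx !andbT [0 == _]eq_sym subr_eq0.
split=> [[c Dc] t tau|h].
  have [->|tt] := eqVneq t tau.
    by rewrite subrr; apply/pcov_diag_eq; rewrite !Dc !subrr.
  have [ne ne'] := offdiag _ _ tt.
  apply/(pcov_pair_eq ne ne'); rewrite ?Dc ?subrr//.
  by rewrite -!Dc DopC !Dc sub0r opprB.
have diag t : Dop X a a t t = Dop X a a 0 0.
  by apply/pcov_diag_eq; rewrite h subrr.
exists (Dop X a a 0) => t tau; have [->|tt] := eqVneq t tau.
  by rewrite subrr diag.
have [ne ne'] := offdiag _ _ tt.
by apply/(pcov_pair_eq ne ne') => //; rewrite [LHS]diag diag.
Qed.

Lemma toeplitz_pcov_node a : toeplitz (pcov X a a) <->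
  (forall t tau, pcov X a a t tau = pcov X a a 0 (t - tau)).
Proof.
split=> [[c rc] t tau|h]; last by exists (pcov X a a 0).
by rewrite pcovC !rc sub0r opprB.
Qed.

Lemma toeplitz_Dop_diag a t t' : toeplitz (Dop X a a) ->
  Dop X a a t t = Dop X a a t' t'.
Proof. by move=> [c Dc]; rewrite !Dc !subrr. Qed.

Lemma toeplitz_pair a b : a != b ->
  toeplitz (Dop X a a) -> toeplitz (Dop X b b) ->
  toeplitz (Dop X a b) <-> toeplitz (pcov X a b).
Proof.
move=> ab Ta Tb; have ne (t tau : int) : (t, a) != (tau, b).
  by rewrite xpair_eqE (negPf ab) andbF.
have transfer t tau : pcov X a b t tau = pcov X a b (t - tau) 0 <->
    Dop X a b t tau = Dop X a b (t - tau) 0.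
  by apply: pcov_pair_eq; rewrite ?ne//; exact: toeplitz_Dop_diag.
split=> [[c Dc]|[c rc]].
  exists (pcov X a b ^~ 0) => t tau; apply/transfer.
  by rewrite !Dc subr0.
exists (Dop X a b ^~ 0) => t tau; apply/transfer.
by rewrite !rc subr0.
Qed.

End identification.
End frame.

Theorem proposition2p1 (d : measure_display) (T : measurableType d)
    (R : realType) (P : probability T R) (p : nat) (p_ge1 : (1 <= p)%N)
    (X : int -> 'I_p -> {RV P >-> R})
    (X_L2 : forall t a, (X t a : T -> R) \in Lfun P 2%:E)
    (X_centred : forall t a, 'E_P[X t a]%E = 0%E)
    (C_bounded :
      (ereal_sup [set (mx_norm (acov X t t))%:E | t in [set: int]] < +oo)%E)
    (C_lambda : [/\ (0 < lambda_inf (Cop X))%E,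
                    (lambda_inf (Cop X) <= lambda_sup (Cop X))%E &
                    (lambda_sup (Cop X) < +oo)%E]) :
  [/\
      forall a b : 'I_p, a != b ->
        ((forall t tau, pcov X a b t tau = 0) <->
         (forall t tau, Dop X a b t tau = 0)),
      forall a : 'I_p,
        (toeplitz (Dop X a a) <->
         (forall t tau, pcov X a a t tau = pcov X a a 0 (t - tau))) /\
        ((forall t tau, pcov X a a t tau = pcov X a a 0 (t - tau)) <->
         toeplitz (pcov X a a)) &
      forall a b : 'I_p, a != b ->
        ([/\ toeplitz (Dop X a a), toeplitz (Dop X b b) &
             toeplitz (Dop X a b)] <->
         [/\ toeplitz (pcov X a a), toeplitz (pcov X b b) &
             toeplitz (pcov X a b)])].

Proof.
have [lam0 lamle lamoo] := C_lambda.
have [m [M [m0 M0 lower upper]]] := frame_bounds X_L2 X_centred lam0 lamle lamoo.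
have node a := toeplitz_Dop_node X_L2 X_centred m0 M0 lower upper a.
have rnode a := toeplitz_pcov_node X a.
split.
- move=> a b ab; have ne (t tau : int) : (t, a) != (tau, b).
    by rewrite xpair_eqE (negPf ab) andbF.
  have eq0 t tau := pcov_eq0 X_L2 X_centred m0 M0 lower upper (ne t tau).
  by split=> h t tau; apply/eq0.
- by move=> a; split; [exact: node|apply: iff_sym; exact: rnode].
- move=> a b ab; have pair := toeplitz_pair X_L2 X_centred m0 M0 lower upper ab.
  split=> [[Ta Tb Tab]|[Ta Tb Tab]].
    by split; [exact/rnode/node|exact/rnode/node|exact/pair].
  have [Da Db] : toeplitz (Dop X a a) /\ toeplitz (Dop X b b).
    by split; exact/node/rnode.
  by split=> //; exact/pair.
Qed.
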